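(* Let $\theta\ge0$ and $g_d\in L^2(\Omega)$. For $\nu>0$ let $(Su_\nu,u_\nu)$ solve the problem: minimise $$J^\theta_\nu(y,\eta)=\frac12\sum_{\omega\in I}(y(\omega)-g_\omega)^2+\nu\Big(\frac12\theta\|y-g_d\|_{L^2(\Omega)}^2+\frac12\|\eta\|_{L^2(\Omega)}^2\Big)$$ over $(y,\eta)\in C_0(\Omega)\times L^2(\Omega)$ subject to $y=S\eta$. Let $(S\bar u,\bar u)$ solve the problem: minimise $$J^\theta(y,\eta)=\frac12\theta\|y-g_d\|_{L^2(\Omega)}^2+\frac12\|\eta\|_{L^2(\Omega)}^2$$ over $(y,\eta)\in H_0^1(\Omega)\times L^2(\Omega)$ subject to $y=S\eta$ and $y(\omega)=g_\omega$ for all $\omega\in I$. Then as $\nu\to0$, $$Su_\nu\rightharpoonup S\bar u\ \text{ weakly in } H_0^1(\Omega),\qquad u_\nu\rightharpoonup\bar u\ \text{ weakly in } L^2(\Omega).$$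
   Context: $\Omega\subset\mathbb{R}^n$ ($n=2$ or $3$) is a bounded open set that either has a $C^{1,1}$ boundary or is convex with polygonal ($n=2$) or polyhedral ($n=3$) boundary. $a(z,v)=\sum_{i,j=1}^n\int_\Omega a_{ij}\,\partial_{x_i}z\,\partial_{x_j}v\,dx+\int_\Omega a_0zv\,dx$, with $a_0\in L^\infty(\Omega)$, $a_0\ge 0$ a.e., $a_{ij}=a_{ji}\in C^{0,1}(\bar\Omega)$, and for some $\alpha>0$, $\sum_{i,j}a_{ij}(x)\xi_i\xi_j\ge\alpha|\xi|^2$ for all $x\in\Omega$, $\xi\in\mathbb{R}^n$. $C_0(\Omega)$ is the space of functions in $C(\bar\Omega)$ vanishing on $\partial\Omega$. $S:L^2(\Omega)\to C_0(\Omega)$ maps $\eta$ to the unique $y\in H_0^1(\Omega)$ with $a(y,v)=(\eta,v)_{L^2(\Omega)}$ for all $v\in H_0^1(\Omega)$ (this $y$ lies in $H^2(\Omega)\cap H^1_0(\Omega)\subset C_0(\Omega)$, so point values of $y$ make sense). $I\subset\Omega$ is a finite set of points and $g_\omega\in\mathbb{R}$ for $\omega\in I$. There are no control constraints. *)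

(* Defs.v *)
From HB Require Import structures.
From mathcomp Require Import all_boot all_order all_algebra.
From mathcomp Require Import all_classical all_reals all_analysis.

Set Implicit Arguments.
Unset Strict Implicit.
Unset Printing Implicit Defensive.

Import Order.TTheory GRing.Theory Num.Theory.
Import numFieldNormedType.Exports.

Local Open Scope classical_set_scope.
Local Open Scope ring_scope.

Section rV_measurable.
Context {d : measure_display} {T : sigmaRingType d} {n : nat}.

(* Product sigma-algebra of the coordinates; over a realType it is the Borel
   sigma-algebra of R^n. *)
Definition rV_coord (i : 'I_n) (x : 'rV[T]_n) : T := x ord0 i.

Let rV_set0 : g_sigma_preimage rV_coord set0.
Proof. exact: sigma_algebra0. Qed.

Let rV_setC A : g_sigma_preimage rV_coord A -> g_sigma_preimage rV_coord (~` A).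
Proof. exact: sigma_algebraC. Qed.

Let rV_bigcup (F : (set 'rV[T]_n)^nat) :
  (forall i, g_sigma_preimage rV_coord (F i)) ->
  g_sigma_preimage rV_coord (\bigcup_i (F i)).
Proof. exact: sigma_algebra_bigcup. Qed.

HB.instance Definition _ := @isMeasurable.Build (measure_tuple_display d)
  'rV[T]_n (g_sigma_preimage rV_coord) rV_set0 rV_setC rV_bigcup.
End rV_measurable.


Section lebesgue_rV.
Variable R : realType.

Definition rV_cons n (p : measurableTypeR R * 'rV[R]_n) : 'rV[R]_n.+1 :=
  row_mx p.1%:M p.2.

Lemma rV_cons_ord0 n p : @rV_cons n p ord0 ord0 = p.1.
Proof.
have e : (ord0 : 'I_n.+1) = lshift n (ord0 : 'I_1) by apply/val_inj.
have := row_mxEl (p.1%:M : 'M[R]_1) p.2 ord0 (ord0 : 'I_1).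
by rewrite [RHS]mxE mulr1n -e.
Qed.

Lemma rV_cons_lift n p (j : 'I_n) : rV_cons p ord0 (lift ord0 j) = p.2 ord0 j.
Proof.
have e : lift ord0 j = rshift 1 j by apply/val_inj.
by have := row_mxEr (p.1%:M : 'M[R]_1) p.2 ord0 j; rewrite -e.
Qed.

Lemma measurable_rV_coord n (i : 'I_n) :
  measurable_fun [set: 'rV[R]_n] (rV_coord i).
Proof.
move=> _ Y mY; rewrite setTI; apply: sub_sigma_algebra => /=.
rewrite -bigcup_seq/=; exists i => /=; first by rewrite mem_index_enum.
by exists Y => //; rewrite setTI.
Qed.

Lemma measurable_fun_rV d (T : measurableType d) n (f : T -> 'rV[R]_n) :
  (forall i, measurable_fun [set: T] (fun x => f x ord0 i)) ->
  measurable_fun [set: T] f.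
Proof.
move=> mf.
suff H : g_sigma_preimage (@rV_coord _ R n) `<=`
    image_set_system [set: T] f measurable.
  by move=> _ Y mY; exact: H.
apply: smallest_sub.
  exact/sigma_algebra_image/sigma_algebra_measurable.
rewrite -bigcup_seq => A [i /= _ [B mB <-]].
by rewrite /image_set_system/= setTI; exact: mf.
Qed.

Lemma measurable_rV_cons n : measurable_fun setT (@rV_cons n).
Proof.
apply: measurable_fun_rV => i; case: (unliftP ord0 i) => [j|] ->.
  rewrite (_ : (fun x => _) = rV_coord j \o snd); last first.
    by apply/funext => p /=; rewrite rV_cons_lift.
  exact: measurableT_comp (measurable_rV_coord j) measurable_snd.
rewrite (_ : (fun x => _) = fst); first exact: measurable_fst.
by apply/funext => p /=; rewrite rV_cons_ord0.
Qed.

Section step.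
Variables (n : nat) (m : {sigma_finite_measure set 'rV[R]_n -> \bar R}).

Definition lebesgue_rV_step : set 'rV[R]_n.+1 -> \bar R :=
  pushforward (lebesgue_measure \x m)%E (@rV_cons n).

Let step0 : lebesgue_rV_step set0 = 0%E.
Proof. by rewrite /lebesgue_rV_step /pushforward preimage_set0 measure0. Qed.

Let step_ge0 A : (0 <= lebesgue_rV_step A)%E.
Proof. exact: (@measure_ge0 _ _ _ (lebesgue_measure \x m)%E). Qed.

Let step_sigma_additive : semi_sigma_additive lebesgue_rV_step.
Proof.
have mc A : measurable A -> measurable (@rV_cons n @^-1` A).
  by move=> mA; rewrite -[X in measurable X]setTI; apply: measurable_rV_cons.
move=> F mF tF mUF; rewrite /lebesgue_rV_step /pushforward preimage_bigcup.
apply: measure_semi_sigma_additive.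
- by move=> k; apply: mc; exact: mF.
- apply/trivIsetP => /= i j _ _ ij; rewrite -preimage_setI.
  by move/trivIsetP : tF => /(_ _ _ _ _ ij) ->//; rewrite preimage_set0.
- by rewrite -preimage_bigcup; apply: mc; exact: mUF.
Qed.

HB.instance Definition _ := isMeasure.Build _ _ _
  lebesgue_rV_step step0 step_ge0 step_sigma_additive.

Let step_sigma_finite : sigma_finite setT lebesgue_rV_step.
Proof.
have /sigma_finiteP[F0 [TF ndF Foo]] :=
  sigma_finiteT (@lebesgue_measure R).
have /sigma_finiteP[G0 [TG ndG Goo]] := sigma_finiteT m.
pose h (x : 'rV[R]_n.+1) : measurableTypeR R * 'rV[R]_n :=
  (x ord0 ord0, \row_j x ord0 (lift ord0 j)).
have hK p : h (rV_cons p) = p.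
  rewrite /h rV_cons_ord0; case: p => a b /=; congr pair.
  by apply/rowP => j; rewrite mxE rV_cons_lift.
have mh : measurable_fun setT h.
  apply: measurable_fun_pair; first exact: measurable_rV_coord.
  apply: measurable_fun_rV => i.
  rewrite (_ : (fun x => _) = rV_coord (lift ord0 i)).
    exact: measurable_rV_coord.
  by apply/funext => x; rewrite mxE.
exists (fun k => h @^-1` (F0 k `*` G0 k)).
  rewrite -preimage_bigcup; apply/esym; rewrite -[RHS](preimage_setT h).
  congr (_ @^-1` _); apply/seteqP; split => // -[x y] _.
  have [i _ Fx] : (\bigcup_i F0 i) x by rewrite -TF.
  have [j _ Gy] : (\bigcup_i G0 i) y by rewrite -TG.
  exists (maxn i j) => //; split.
  - by move: x Fx; exact/subsetPset/ndF/leq_maxl.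
  - by move: y Gy; exact/subsetPset/ndG/leq_maxr.
move=> k; have [mF Ffin] := Foo k; have [mG Gfin] := Goo k.
have mFG : measurable (F0 k `*` G0 k) by exact: measurableX.
split; first by rewrite -[X in measurable X]setTI; apply: mh.
rewrite /lebesgue_rV_step /pushforward -comp_preimage.
rewrite (_ : h \o _ = id); last by apply/funext => p /=; rewrite hK.
rewrite preimage_id product_measure1E// lte_mul_pinfty//.
by rewrite ge0_fin_numE.
Qed.

HB.instance Definition _ := Measure_isSigmaFinite.Build _ _ _
  lebesgue_rV_step step_sigma_finite.
End step.

Fixpoint lebesgue_rV n : {sigma_finite_measure set 'rV[R]_n -> \bar R} :=
  match n return {sigma_finite_measure set 'rV[R]_n -> \bar R} with
  | 0 => dirac (0 : 'rV[R]_0)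
  | k.+1 => lebesgue_rV_step (lebesgue_rV k)
  end.

End lebesgue_rV.

Lemma lebesgue_rV_box (R : realType) n (A : 'I_n -> set (measurableTypeR R)) :
  (forall i, measurable (A i)) ->
  lebesgue_rV R n [set x | forall i, A i (x ord0 i)] =
  (\prod_(i < n) lebesgue_measure (A i))%E.
Proof.
elim: n A => [|n IH] A mA.
  by rewrite big_ord0 /= diracE mem_set// => -[].
rewrite big_ord_recl -IH//.
transitivity ((lebesgue_measure \x lebesgue_rV R n)%E
  (@rV_cons R n @^-1` [set x | forall i, A i (x ord0 i)])); first by [].
have -> : @rV_cons R n @^-1` [set x | forall i, A i (x ord0 i)] =
    A ord0 `*` [set x : 'rV[R]_n | forall i, A (lift ord0 i) (x ord0 i)].
  apply/seteqP; split => p /=.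
    move=> H; split => [|i]; first by have := H ord0; rewrite rV_cons_ord0.
    by have := H (lift ord0 i); rewrite rV_cons_lift.
  move=> [H0 H] i; case: (unliftP ord0 i) => [j|] ->.
    by rewrite rV_cons_lift.
  by rewrite rV_cons_ord0.
rewrite product_measure1E//.
rewrite (_ : mkset _ =
    \bigcap_(i in setT) (rV_coord i @^-1` A (lift ord0 i))); last first.
  by apply/seteqP; split => x /= H i; [move=> _|]; apply: H.
apply: fin_bigcap_measurable => // i _.
rewrite -[X in measurable X]setTI.
by apply: (@measurable_rV_coord R n) => //; exact: mA.
Qed.

Section domain.
Variables (R : realType) (n : nat).
Implicit Types (Omega : set 'rV[R]_n).

Definition bdry Omega : set 'rV[R]_n := closure Omega `\` interior Omega.

Definition partial m (i : 'I_m) (f : 'rV[R]_m -> R) : 'rV[R]_m -> R :=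
  'D_(delta_mx ord0 i) f.

Definition C11_on m (V : set 'rV[R]_m) (f : 'rV[R]_m -> R) : Prop :=
  (forall x, V x -> differentiable f x) /\
  (forall i, [lipschitz partial i f x | x in V]).

(* Near each boundary point, in orthogonal coordinates [y] centred there (the
   [k]-th one playing the role of the last), Omega is the strict subgraph and
   its boundary the graph of a C^{1,1} function of the other coordinates. *)
Definition C11_boundary Omega : Prop :=
  forall x0, bdry Omega x0 ->
  exists (Q : 'M[R]_n) (k : 'I_n) (r : 'I_n -> R) (gamma : 'rV[R]_n.-1 -> R),
    let y (x : 'rV[R]_n) := (x - x0) *m Q in
    let V := [set x | forall j, `|y x ord0 j| < r j] in
    let V' := [set t : 'rV[R]_n.-1 | forall j, `|t ord0 j| < r (lift k j)] in
    [/\ Q *m Q^T = 1%:M, (forall j, 0 < r j),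
        C11_on V' gamma /\ (forall t, V' t -> `|gamma t| <= r k / 2),
        (forall x, V x -> (Omega x <-> y x ord0 k < gamma (col' k (y x)))) &
        (forall x, V x -> (bdry Omega x <-> y x ord0 k = gamma (col' k (y x))))].

Definition convex_hull (s : seq 'rV[R]_n) : set 'rV[R]_n :=
  [set x | exists t : 'I_(size s) -> R,
    [/\ (forall i, 0 <= t i), \sum_i t i = 1 & x = \sum_i t i *: s`_i]].

(* For n = 2 the faces are segments, for n = 3 flat convex polygons. *)
Definition polyhedral_boundary Omega : Prop :=
  exists faces : seq (seq 'rV[R]_n),
    (forall F, F \in faces -> exists (e : 'rV[R]_n) (c : R), e != 0 /\
       forall p, p \in F -> (e *m p^T) ord0 ord0 = c) /\
    bdry Omega = \bigcup_(F in [set` faces]) convex_hull F.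

Definition admissible_domain Omega : Prop :=
  [/\ open Omega, bounded_set Omega &
    C11_boundary Omega \/
    convex_set (Omega : set (convex_lmodType 'rV[R]_n)) /\
    polyhedral_boundary Omega].

End domain.

(* Elements of all function spaces over Omega are represented by total functions
   on R^n, of which only the values on Omega (on its closure, for [C0]) matter. *)
Section function_spaces.
Variables (R : realType) (n : nat) (Omega : set 'rV[R]_n).
Local Notation E := 'rV[R]_n.
Local Notation mu := (lebesgue_rV R n).

Definition C0 (f : E -> R) : Prop :=
  {within closure Omega, continuous f} /\ (forall x, bdry Omega x -> f x = 0).

Definition L2 (f : E -> R) : Prop :=
  measurable_fun Omega f /\ mu.-integrable Omega (fun x => (f x ^+ 2)%:E).

Definition Linfty (f : E -> R) : Prop :=
  measurable_fun Omega f /\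
  exists M : R, {ae mu, forall x, Omega x -> `|f x| <= M}.

Definition L2ip (f g : E -> R) : R := \int[mu]_(x in Omega) (f x * g x).

Definition L2norm (f : E -> R) : R := Num.sqrt (L2ip f f).

(* Differentiability of every iterated partial derivative gives C^infinity. *)
Definition smooth (phi : E -> R) : Prop :=
  forall (s : seq 'I_n) x, differentiable (foldr (@partial R n) phi s) x.

Definition test_fun (phi : E -> R) : Prop :=
  [/\ smooth phi, compact (closure [set x | phi x != 0]) &
      closure [set x | phi x != 0] `<=` Omega].

Definition weak_partial (i : 'I_n) (f g : E -> R) : Prop :=
  forall phi, test_fun phi -> L2ip f (partial i phi) = - L2ip g phi.

(* [f] belongs to H^1(Omega), with weak gradient [Df]; the latter is determined
   by [f] almost everywhere on Omega. *)
Definition H1 (f : E -> R) (Df : 'I_n -> E -> R) : Prop :=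
  [/\ L2 f, (forall i, L2 (Df i)) & (forall i, weak_partial i f (Df i))].

Definition H1norm (f : E -> R) (Df : 'I_n -> E -> R) : R :=
  Num.sqrt (L2norm f ^+ 2 + \sum_i L2norm (Df i) ^+ 2).

(* Closure of the test functions in H^1. *)
Definition H10 (f : E -> R) : Prop :=
  exists Df, H1 f Df /\
  exists phi : nat -> E -> R, (forall k, test_fun (phi k)) /\
    H1norm (f \- phi k) (fun i => Df i \- partial i (phi k)) @[k --> \oo] --> 0.

Definition bilin (A : 'I_n -> 'I_n -> E -> R) (a0 : E -> R)
    (z : E -> R) (Dz : 'I_n -> E -> R) (v : E -> R) (Dv : 'I_n -> E -> R) : R :=
  \sum_i \sum_j \int[mu]_(x in Omega) (A i j x * Dz i x * Dv j x) +
  \int[mu]_(x in Omega) (a0 x * z x * v x).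

Definition weak_solution (A : 'I_n -> 'I_n -> E -> R) (a0 : E -> R)
    (eta y : E -> R) : Prop :=
  H10 y /\
  forall v, H10 v -> forall Dy Dv, H1 y Dy -> H1 v Dv ->
    bilin A a0 y Dy v Dv = L2ip eta v.

Definition linear_on (V : set (E -> R)) (F : (E -> R) -> R) : Prop :=
  forall (c : R) f g, V f -> V g ->
    F (fun x => c * f x + g x) = c * F f + F g.

Definition L2_dual (F : (E -> R) -> R) : Prop :=
  linear_on L2 F /\
  exists C : R, forall f, L2 f -> `|F f| <= C * L2norm f.

Definition H10_dual (F : (E -> R) -> R) : Prop :=
  linear_on H10 F /\
  exists C : R, forall f Df, H10 f -> H1 f Df -> `|F f| <= C * H1norm f Df.

End function_spaces.

Section control.
Variables (R : realType) (n : nat) (Omega : set 'rV[R]_n).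
Local Notation E := 'rV[R]_n.

Definition coefficients (A : 'I_n -> 'I_n -> E -> R) (a0 : E -> R) : Prop :=
  [/\ Linfty Omega a0,
      {ae lebesgue_rV R n, forall x, Omega x -> 0 <= a0 x},
      (forall i j, [lipschitz A i j x | x in closure Omega]),
      (forall i j x, closure Omega x -> A i j x = A j i x) &
      exists alpha : R, 0 < alpha /\
        forall x, Omega x -> forall xi : 'rV[R]_n,
          alpha * \sum_i xi ord0 i ^+ 2 <=
          \sum_i \sum_j A i j x * xi ord0 i * xi ord0 j].

(* [S : L^2(Omega) -> C_0(Omega)]: the values of [S eta] are those of the
   continuous representative, so that point evaluation makes sense. *)
Definition solution_operator (A : 'I_n -> 'I_n -> E -> R) (a0 : E -> R)
    (S : (E -> R) -> E -> R) : Prop :=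
  forall eta, L2 Omega eta ->
    C0 Omega (S eta) /\ weak_solution Omega A a0 eta (S eta).

Definition J (theta : R) (gd y eta : E -> R) : R :=
  theta / 2 * L2norm Omega (y \- gd) ^+ 2 + L2norm Omega eta ^+ 2 / 2.

Definition Jnu (I : set E) (g : E -> R) (theta nu : R) (gd y eta : E -> R) : R :=
  1 / 2 * (\sum_(w \in I) (y w - g w) ^+ 2) + nu * J theta gd y eta.

Definition minimises (K : (E -> R) -> (E -> R) -> Prop)
    (f : (E -> R) -> (E -> R) -> R) (y eta : E -> R) : Prop :=
  K y eta /\ forall y' eta', K y' eta' -> f y eta <= f y' eta'.

Definition feasible_nu (S : (E -> R) -> E -> R) (y eta : E -> R) : Prop :=
  [/\ C0 Omega y, L2 Omega eta & y = S eta].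

(* Point values of [y] are meaningful because of the constraint [y = S eta]. *)
Definition feasible (S : (E -> R) -> E -> R) (I : set E) (g y eta : E -> R) : Prop :=
  [/\ H10 Omega y, L2 Omega eta, y = S eta & forall w, I w -> y w = g w].

End control.

(* Main.v *)
(* The convergence is in fact strong. Comparing u_nu with ubar gives
   J(u_nu) <= J(ubar) and sum_w (S u_nu(w) - g_w)^2 <= 2 nu J(ubar). The map
   eta |-> (S eta(w))_(w in I) is linear of finite rank, so u_nu can be moved onto
   the constraint by a correction of size O(sqrt nu) in L^2 (together with its
   image under S). The corrected control is feasible and almost optimal, hence
   close to ubar by strong convexity of J; no weak compactness, and no bound on
   point values of S eta, is required.
   Linearity of S and its boundedness from L^2 to H^1 come from ellipticity and
   the Poincare inequality. The latter follows from the definition of the weak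
   derivative: if test functions phi_k tend to f in H^1, testing with x_i phi_k
   gives |f|^2 = - 2 (x_i f, D_i f) in the limit. *)
Require Import Defs.
From HB Require Import structures.
From mathcomp Require Import all_boot all_order all_algebra.
From mathcomp Require Import all_classical all_reals all_analysis.
From mathcomp Require Import measurable_realfun ring lra.

Set Implicit Arguments.
Unset Strict Implicit.
Unset Printing Implicit Defensive.

Import Order.TTheory GRing.Theory Num.Theory.
Import numFieldNormedType.Exports.

Local Open Scope classical_set_scope.
Local Open Scope ring_scope.

Lemma normr_sqr (R : realDomainType) (x : R) : `|x| ^+ 2 = x ^+ 2.
Proof. by rewrite real_normK ?num_real. Qed.

Lemma ler_normr_sqr (R : realDomainType) (x M : R) : `|x| <= M -> x ^+ 2 <= M ^+ 2.
Proof. by rewrite ler_norml => /andP[? ?]; nra. Qed.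

(** * Calculus in L^2: pairing, norm and bounded multipliers *)

Section L2_calculus.
Variables (R : realType) (n : nat) (Omega : set 'rV[R]_n).
Hypothesis mOmega : measurable Omega.
Local Notation E := 'rV[R]_n.
Local Notation mu := (lebesgue_rV R n).
Implicit Types (f g h b : E -> R).

(** Domination by $f^2 + g^2$. *)
Lemma L2_integrableM f g : L2 Omega f -> L2 Omega g ->
  mu.-integrable Omega (EFin \o (fun x => f x * g x)).
Proof.
move=> [mf f2] [mg g2].
apply: (@le_integrable _ _ _ mu _ mOmega _
  (EFin \o (fun x => f x ^+ 2 + g x ^+ 2))).
- by apply/measurable_EFinP; exact: measurable_funM.
- move=> x _ /=; rewrite lee_fin normrM [leRHS]ger0_norm ?addr_ge0 ?sqr_ge0//.
  rewrite -(normr_sqr (f x)) -(normr_sqr (g x)); nra.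
- exact: (integrableD mOmega f2 g2).
Qed.

Lemma L2ipC f g : L2ip Omega f g = L2ip Omega g f.
Proof. by apply: eq_Rintegral => x _; rewrite mulrC. Qed.

Lemma L2ip_ext f f' g g' : (forall x, Omega x -> f x = f' x) ->
  (forall x, Omega x -> g x = g' x) -> L2ip Omega f g = L2ip Omega f' g'.
Proof. by move=> ff gg; apply: eq_Rintegral => x /set_mem Ox; rewrite ff ?gg. Qed.

Lemma L2norm_ext f f' : (forall x, Omega x -> f x = f' x) ->
  L2norm Omega f = L2norm Omega f'.
Proof. by move=> ff; rewrite /L2norm (L2ip_ext ff ff). Qed.

Lemma L2_lin c f g : L2 Omega f -> L2 Omega g -> L2 Omega (fun x => c * f x + g x).
Proof.
move=> Lf Lg; have [mf f2] := Lf; have [mg g2] := Lg.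
have mcf : measurable_fun Omega (fun x => c * f x).
  by apply: measurable_funM => //; exact: measurable_cst.
split; first exact: measurable_funD.
have /(integrableZl mOmega (2 * c)) ifg := L2_integrableM Lf Lg.
have /(integrableZl mOmega (c ^+ 2)) iff := f2.
apply: eq_integrable (integrableD mOmega (integrableD mOmega iff g2) ifg) => //.
by move=> x _ /=; rewrite -!EFinM -!EFinD; congr EFin; ring.
Qed.

Lemma L2_0 : L2 Omega (fun=> 0).
Proof.
split; first exact: measurable_cst.
rewrite (_ : (fun=> _) = cst 0%E); first exact: integrable0.
by apply/funext => x; rewrite expr0n.
Qed.

Lemma L2_sub f g : L2 Omega f -> L2 Omega g -> L2 Omega (f \- g).
Proof.
move=> Lf Lg; rewrite (_ : _ \- _ = fun x => -1 * g x + f x).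
  exact: L2_lin.
by apply/funext => x /=; ring.
Qed.

Lemma L2ip_linl c f g h : L2 Omega f -> L2 Omega g -> L2 Omega h ->
  L2ip Omega (fun x => c * f x + g x) h = c * L2ip Omega f h + L2ip Omega g h.
Proof.
move=> Lf Lg Lh; have ifh := L2_integrableM Lf Lh.
have igh := L2_integrableM Lg Lh.
rewrite /L2ip -RintegralZl// -RintegralD//; last exact: (integrableZl mOmega c ifh).
by apply: eq_Rintegral => x _; ring.
Qed.

Lemma L2ip_linr c f g h : L2 Omega f -> L2 Omega g -> L2 Omega h ->
  L2ip Omega h (fun x => c * f x + g x) = c * L2ip Omega h f + L2ip Omega h g.
Proof. by move=> *; rewrite ![L2ip _ h _]L2ipC L2ip_linl. Qed.

Lemma L2ip_subr f g h : L2 Omega f -> L2 Omega g -> L2 Omega h ->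
  L2ip Omega h (f \- g) = L2ip Omega h f - L2ip Omega h g.
Proof.
move=> Lf Lg Lh; rewrite (@L2ip_ext _ h _ (fun x => -1 * g x + f x))//.
  by rewrite L2ip_linr//; ring.
by move=> x _ /=; ring.
Qed.

Lemma L2ip_ge0 f : 0 <= L2ip Omega f f.
Proof. by apply: Rintegral_ge0 => x _; rewrite -expr2 sqr_ge0. Qed.

Lemma L2norm_ge0 f : 0 <= L2norm Omega f. Proof. exact: sqrtr_ge0. Qed.

Lemma L2norm0 : L2norm Omega (fun=> 0) = 0.
Proof. by rewrite /L2norm /L2ip mul0r Rintegral_cst// mul0r sqrtr0. Qed.

Lemma L2norm_sqr f : L2norm Omega f ^+ 2 = L2ip Omega f f.
Proof. by rewrite sqr_sqrtr// L2ip_ge0. Qed.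

Lemma L2ip_sqr_lin c f g : L2 Omega f -> L2 Omega g ->
  L2ip Omega (fun x => c * f x + g x) (fun x => c * f x + g x) =
  c ^+ 2 * L2ip Omega f f + 2 * c * L2ip Omega f g + L2ip Omega g g.
Proof.
move=> Lf Lg; rewrite L2ip_linl ?L2ip_linr//; last exact: L2_lin.
by rewrite (L2ipC g f); ring.
Qed.

(** The quadratic $c \mapsto |c f + g|^2$ is nonnegative for every real $c$. *)
Lemma L2_CauchySchwarz f g : L2 Omega f -> L2 Omega g ->
  `|L2ip Omega f g| <= L2norm Omega f * L2norm Omega g.
Proof.
move=> Lf Lg; rewrite -(@ler_pXn2r _ 2)// ?nnegrE ?mulr_ge0 ?L2norm_ge0//.
rewrite normr_sqr exprMn !L2norm_sqr.
have H c : 0 <= c ^+ 2 * L2ip Omega f f + 2 * c * L2ip Omega f g + L2ip Omega g g.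
  by rewrite -L2ip_sqr_lin// L2ip_ge0.
have [ff0|ff0] := eqVneq (L2ip Omega f f) 0.
  rewrite ff0 mul0r; have [->|p0] := eqVneq (L2ip Omega f g) 0.
    by rewrite expr0n.
  (* With $|f| = 0$ the quadratic is affine in $c$; this $c$ gives it the value $-|g|^2 - 2 < 0$. *)
  have := H (- (L2ip Omega g g + 1) / L2ip Omega f g).
  rewrite ff0 mulr0 add0r -mulrA divfK// => H1.
  by have := L2ip_ge0 g; lra.
have ffp : 0 < L2ip Omega f f by rewrite lt_neqAle eq_sym ff0 L2ip_ge0.
(* The minimiser of the quadratic. *)
have := H (- L2ip Omega f g / L2ip Omega f f).
set p := L2ip Omega f g; set q := L2ip Omega f f in ff0 ffp *.
rewrite -(@pmulr_rge0 _ q)//.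
suff -> : q * ((- p / q) ^+ 2 * q + 2 * (- p / q) * p + L2ip Omega g g) =
  q * L2ip Omega g g - p ^+ 2 by rewrite subr_ge0.
by field.
Qed.

Lemma L2norm_lin c f g : L2 Omega f -> L2 Omega g ->
  L2norm Omega (fun x => c * f x + g x) <= `|c| * L2norm Omega f + L2norm Omega g.
Proof.
move=> Lf Lg.
rewrite -(@ler_pXn2r _ 2)// ?nnegrE ?addr_ge0 ?mulr_ge0 ?L2norm_ge0//.
rewrite L2norm_sqr L2ip_sqr_lin// sqrrD exprMn !L2norm_sqr normr_sqr.
rewrite lerD2r lerD2l -mulrA -[leRHS]mulr_natl ler_pM2l//.
apply: (le_trans (ler_norm _)); rewrite normrM -mulrA ler_wpM2l//.
exact: L2_CauchySchwarz.
Qed.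

(** The bound holds at every point of Omega, so estimates of products involve no null sets.
    Coefficients in [Linfty] are first replaced by such functions. *)
Definition bounded_coef b :=
  measurable_fun Omega b /\ exists M : R, 0 <= M /\ forall x, Omega x -> `|b x| <= M.

Lemma L2_coefM b f : bounded_coef b -> L2 Omega f -> L2 Omega (fun x => b x * f x).
Proof.
move=> [mb [M [M0 bM]]] [mf f2].
have mbf : measurable_fun Omega (fun x => b x * f x) by exact: measurable_funM.
split=> //; apply: (le_integrable mOmega _ _ (integrableZl mOmega (M ^+ 2) f2)).
- by apply/measurable_EFinP; exact: measurable_funX.
- move=> x Ox; rewrite -EFinM !abse_EFin lee_fin.
  rewrite ger0_norm ?sqr_ge0// (ger0_norm (mulr_ge0 (sqr_ge0 _) (sqr_ge0 _))).
  rewrite exprMn ler_wpM2r ?sqr_ge0//.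
  exact/ler_normr_sqr/bM.
Qed.

Lemma L2norm_coefM b f M : measurable_fun Omega b -> 0 <= M ->
    (forall x, Omega x -> `|b x| <= M) -> L2 Omega f ->
  L2norm Omega (fun x => b x * f x) <= M * L2norm Omega f.
Proof.
move=> mb M0 bM Lf; have Lbf : L2 Omega (fun x => b x * f x).
  by apply: L2_coefM => //; split => //; exists M.
rewrite -(@ler_pXn2r _ 2)// ?nnegrE ?mulr_ge0 ?L2norm_ge0// exprMn !L2norm_sqr.
rewrite /L2ip -RintegralZl//; last exact: L2_integrableM.
apply: le_Rintegral => //; first exact: L2_integrableM.
  apply: (integrableZl mOmega (M ^+ 2) (L2_integrableM Lf Lf)).
move=> x Ox; rewrite mulrACA -!expr2 ler_wpM2r ?sqr_ge0//.
exact/ler_normr_sqr/bM.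
Qed.

Lemma bounded_L2 b : (mu Omega < +oo)%E -> bounded_coef b -> L2 Omega b.
Proof.
move=> muO [mb [M [M0 bM]]]; split => //.
apply: (measurable_bounded_integrable mOmega muO); first exact: measurable_funX.
exists (M ^+ 2); split; first by rewrite num_real.
move=> N MN x Ox /=; apply: le_trans (ltW MN).
by rewrite ger0_norm ?sqr_ge0//; exact/ler_normr_sqr/bM.
Qed.

End L2_calculus.

(** * Borel measurability and continuous functions on R^n *)

Section borel_rV.
Variables (R : realType) (n : nat).
Local Notation E := 'rV[R]_n.
Local Notation mu := (lebesgue_rV R n).
Implicit Types (O : set E) (f : E -> R).

Lemma coord_le_norm (x : E) i : `|x ord0 i| <= `|x|.
Proof.
by rewrite [leRHS]/Num.norm/= mx_normrE; apply/bigmax_geP; right; exists (ord0, i).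
Qed.

Lemma measurable_box (B : 'I_n -> set (measurableTypeR R)) :
  (forall i, measurable (B i)) -> measurable [set x : E | forall i, B i (x ord0 i)].
Proof.
move=> mB.
rewrite (_ : mkset _ = \bigcap_(i in setT) (rV_coord i @^-1` B i)).
  apply: fin_bigcap_measurable => // i _.
  rewrite -[X in measurable X]setTI.
  by apply: (@measurable_rV_coord R n) => //; exact: mB.
by apply/seteqP; split => x /= H i; [move=> _|]; apply: H.
Qed.

(** The sigma-algebra is generated by the coordinates, hence contains all boxes. Balls of the sup
    norm are boxes, so an open set is the union of the countably many rational boxes inside it. *)
Lemma open_rV_measurable O : open O -> measurable O.
Proof.
move=> oO.
pose box (pq : 'rV[rat]_n * 'rV[rat]_n) :=
  [set x : E | forall i, `]ratr (pq.1 ord0 i), ratr (pq.2 ord0 i)[%classic (x ord0 i)].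
have -> : O = \bigcup_pq [set x | box pq x /\ box pq `<=` O].
  apply/seteqP; split => [x Ox|x [pq _ [/[swap]]]]; last exact.
  have /nbhs_ballP[e /= e0 xeO] := open_nbhs_nbhs (conj oO Ox).
  have pP i : {p : rat | ratr p \in `](x ord0 i - e), (x ord0 i)[}.
    by apply/cid/rat_in_itvoo; rewrite ltrBlDr ltrDl.
  have qP i : {q : rat | ratr q \in `](x ord0 i), (x ord0 i + e)[}.
    by apply/cid/rat_in_itvoo; rewrite ltrDl.
  exists (\row_i sval (pP i), \row_i sval (qP i)) => //; split => [i|y by_].
    rewrite /= !mxE in_itv/=; have := svalP (pP i); have := svalP (qP i).
    by rewrite !in_itv/= => /andP[-> _] /andP[_ ->].
  apply: xeO; split => // k i; rewrite (ord1 k).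
  have := by_ i; rewrite /= !mxE in_itv/=.
  have := svalP (pP i); have := svalP (qP i); rewrite !in_itv/= /ball/=.
  by move=> /andP[? ?] /andP[? ?] /andP[? ?]; rewrite ltr_distlC; apply/andP; split; lra.
apply: countable_bigcupT_measurable => [|pq]; first exact: countableP.
(* The union runs over all rational pairs; a box that leaves [O] contributes the empty set. *)
have [bO|bO] := pselect (box pq `<=` O); last first.
  have -> : [set x | box pq x /\ box pq `<=` O] = set0; last by [].
  by apply/seteqP; split => x //= [].
have -> : [set x | box pq x /\ box pq `<=` O] = box pq.
  by apply/seteqP; split => [x []|x bx].
exact: (@measurable_box
  (fun i => `]ratr (pq.1 ord0 i), ratr (pq.2 ord0 i)[%classic)
  (fun=> measurable_itv _)).
Qed.

Lemma bounded_rV_measure O : measurable O -> bounded_set O -> (mu O < +oo)%E.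
Proof.
move=> mO [M [_ bO]].
(* [bounded_set] gives a bound only by numbers strictly above [M], hence [M + 1]. *)
pose B := [set x : E | forall i, `[- (M + 1), M + 1]%classic (x ord0 i)].
have mB : measurable B by exact: (measurable_box (fun=> measurable_itv _)).
apply: (@le_lt_trans _ _ (mu B)).
  apply: le_measure; rewrite ?inE// => x Ox i /=; rewrite in_itv/= -ler_norml.
  by apply: (le_trans (coord_le_norm _ _)); apply: (bO (M + 1) _ x); rewrite ?ltrDl.
have -> := @lebesgue_rV_box R n (fun=> `[- (M + 1), M + 1]%classic)
  (fun=> measurable_itv _).
suff /andP[] : (0 <= \prod_(i < n)
    @lebesgue_measure R `[(- (M + 1))%R, (M + 1)%R]%classic < +oo)%E.
  by [].
elim/big_ind : _ => [|x y /andP[x0 xoo] /andP[y0 yoo]|i _].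
- by rewrite lee01 ltry.
- by rewrite mule_ge0//= lte_mul_pinfty// ge0_fin_numE.
- by rewrite measure_ge0/= lebesgue_measure_itv/=; case: ifP => _; rewrite -?EFinB ltry.
Qed.

Lemma continuous_rV_measurable O f : open O ->
  (forall x, O x -> {for x, continuous f}) -> measurable_fun O f.
Proof.
move=> oO cf; apply: (measurability _ (RGenOpens.measurableE R)).
move=> _ [_ [a [b ->] <-]]; apply: open_rV_measurable.
rewrite openE => x [Ox fx]; apply: filterI; first exact: open_nbhs_nbhs.
by apply: cf => //; apply: open_nbhs_nbhs; split => //; exact: interval_open.
Qed.

(* Open balls of ['rV] are boxes, whose measure is positive. *)
Lemma L2norm_eq0_continuous O f : open O -> L2 O f ->
    (forall x, O x -> {for x, continuous f}) -> L2norm O f = 0 ->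
  forall x, O x -> f x = 0.
Proof.
move=> oO Lf cf f0 x Ox; apply/eqP/negPn/negP => fx0.
have mO := open_rV_measurable oO.
have e0 : 0 < `|f x| / 2 by rewrite divr_gt0 ?normr_gt0.
have /nbhs_ballP[r /= r0 rO] : nbhs x (O `&` [set y | `|f x| / 2 <= `|f y|]).
  apply: filterI; first exact: open_nbhs_nbhs.
  have /cvgrPdist_lt /(_ _ e0) := cf _ Ox.
  apply: filterS => y /= fxy; have := ler_distD 0 (f x) (f y).
  have := lerB_dist (f x) (f y); lra.
pose B := [set y : E | forall i, `]x ord0 i - r, x ord0 i + r[%classic (y ord0 i)].
have BO : B `<=` O `&` [set y | `|f x| / 2 <= `|f y|].
  move=> y By; apply: rO; split => // k i; rewrite (ord1 k).
  by have := By i; rewrite /= in_itv/= /ball/= ltr_distlC.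
have mB : measurable B by exact: (measurable_box (fun=> measurable_itv _)).
have muB : (0 < mu B)%E.
  have -> := @lebesgue_rV_box R n (fun i => `]x ord0 i - r, x ord0 i + r[%classic)
    (fun=> measurable_itv _).
  elim/big_ind : _ => // [a b a0 b0|i _]; first exact: mule_gt0.
  rewrite lebesgue_measure_itv/= lte_fin ifT; last lra.
  by rewrite -EFinB lte_fin; lra.
have BsO : B `<=` O by move=> y /BO[].
have mfB : measurable_fun B f := measurable_funS mO BsO Lf.1.
(* Chebyshev's inequality on the box [B], where $|f| \ge |f(x)|/2$; the right-hand side is zero
   while the left-hand side is positive. *)
have H : (((`|f x| / 2) ^+ 2)%:E * mu B <= \int[mu]_(y in O) (f y ^+ 2)%:E)%E.
  rewrite -integral_cst//.
  apply: (@le_trans _ _ (\int[mu]_(y in B) (f y ^+ 2)%:E)%E).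
    apply: ge0_le_integral => //.
    - by move=> y _; rewrite lee_fin sqr_ge0.
    - exact/measurable_EFinP/measurable_funX.
    - move=> y /BO[_ /= fy]; rewrite lee_fin -(normr_sqr (f y)).
      by rewrite ler_pXn2r ?nnegrE// ltW.
  apply: ge0_subset_integral => //.
  - by apply/measurable_EFinP/measurable_funX; exact: Lf.1.
  - by move=> y _; rewrite lee_fin sqr_ge0.
have I0 : (\int[mu]_(y in O) (f y ^+ 2)%:E = 0)%E.
  have := L2norm_sqr O f; rewrite f0 expr0n/= => /esym.
  rewrite /L2ip /Rintegral => fin0.
  rewrite -[LHS]fineK; first by congr EFin.
  exact: (integrable_fin_num mO Lf.2).
move: H; rewrite I0 leNgt => /negP; apply.
by apply: mule_gt0 => //; rewrite lte_fin exprn_gt0.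
Qed.

(** The library notion asks for the estimate with all sufficiently large constants; here one
    nonnegative constant is extracted. *)
Lemma lipschitz_on_bound O f : [lipschitz f x | x in O] ->
  exists K : R, 0 <= K /\ forall x y, O x -> O y -> `|f x - f y| <= K * `|x - y|.
Proof.
move=> [K [_ fK]]; exists (`|K| + 1); split; first by rewrite addr_ge0.
move=> x y Ox Oy.
by apply: (fK (`|K| + 1) _ (x, y)) => //; rewrite (le_lt_trans (ler_norm _))// ltrDl.
Qed.

(** Measurability comes from continuity, the bound from the value at one point plus the Lipschitz
    constant times the diameter. *)
Lemma lipschitz_bounded_coef O f : open O -> bounded_set O ->
  [lipschitz f x | x in O] -> bounded_coef O f.
Proof.
move=> oO [M [_ bO]] /lipschitz_on_bound[K [K0 fK]]; split.
  apply: continuous_rV_measurable => // x Ox.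
  apply/(@cvgrPdist_lt _ _ _ (nbhs x) (nbhs_filter x)) => e e0.
  (* [K] may vanish, and a divisor is needed for the radius of the ball. *)
  have K1 : 0 < K + 1 by lra.
  have nO : nbhs x O := open_nbhs_nbhs (conj oO Ox).
  have nb : nbhs x (ball x (e / (K + 1))) by apply: nbhsx_ballx; exact: divr_gt0.
  apply: filterS (filterI nO nb) => y [Oy].
  rewrite mx_norm_ball/ball_/= ltr_pdivlMr// => xy.
  apply: (le_lt_trans (fK _ _ Ox Oy)); apply: le_lt_trans xy.
  by rewrite mulrC ler_wpM2l// lerDl.
have [->|/set0P[x0 Ox0]] := eqVneq O set0; first by exists 0; split.
have M0 : 0 <= M + 1 by apply: le_trans (bO (M + 1) _ _ Ox0); rewrite ?ltrDl.
exists (`|f x0| + K * (M + 1 + (M + 1))); split => [|x Ox].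
  by rewrite addr_ge0// mulr_ge0// addr_ge0.
have := fK _ _ Ox Ox0; have := lerB_dist (f x) (f x0).
suff : K * `|x - x0| <= K * (M + 1 + (M + 1)) by lra.
by rewrite ler_wpM2l// (le_trans (ler_normB _ _))// lerD// (bO (M + 1))// ltrDl.
Qed.

(** Continuity on all of R^n bounds [f] on a compact ball containing [O]. *)
Lemma continuous_bounded_coef O f : open O -> bounded_set O -> continuous f ->
  bounded_coef O f.
Proof.
move=> oO bO cf; split.
  by apply: continuous_rV_measurable => // x _; exact: cf.
have [N [Nr bN]] := bO.
pose C : set E := closed_ball (0 : E) (`|N| + 2).
have bC : bounded_set C.
  exists (`|N| + 2); split => // z Nz x; rewrite /C closed_ballE ?ltr_wpDl//.
  by rewrite /closed_ball_/= sub0r normrN => /le_trans; apply; exact: ltW.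
have cC := bounded_closed_compact bC (@closed_ball_closed _ _ _ _).
have /compact_bounded[M [Mr fM]] : compact (f @` C).
  by apply: continuous_compact cC; exact: continuous_subspaceT.
exists (`|M| + 1); split => [|x Ox]; first by rewrite addr_ge0.
apply: (fM (`|M| + 1) _ (f x)); first by rewrite (le_lt_trans (ler_norm _))// ltrDl.
exists x => //; rewrite /C closed_ballE ?ltr_wpDl//= /closed_ball_/= sub0r normrN.
apply: (bN (`|N| + 2) _ x) => //; apply: (le_lt_trans (ler_norm _)); lra.
Qed.

End borel_rV.

(** * Smooth functions and test functions *)

Section test_functions.
Variables (R : realType) (n : nat).
Local Notation E := 'rV[R]_n.
Implicit Types (f g phi psi : E -> R).

Lemma partial_lin i c f g : (forall x, differentiable f x) ->
    (forall x, differentiable g x) ->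
  partial i (fun x => c * f x + g x) = fun x => c * partial i f x + partial i g x.
Proof.
move=> df dg; apply/funext => x; rewrite /partial.
have dfx : derivable f x (delta_mx ord0 i) by apply: diff_derivable.
have dgx : derivable g x (delta_mx ord0 i) by apply: diff_derivable.
rewrite (_ : (fun x => _) = c *: f + g)// deriveD//; last exact: derivableZ.
by rewrite deriveZ.
Qed.

Lemma smooth_differentiable f : smooth f -> forall x, differentiable f x.
Proof. by move=> sf x; exact: (sf [::]). Qed.

Lemma smooth_partial i f : smooth f -> smooth (partial i f).
Proof. by move=> sf s x; have := sf (rcons s i) x; rewrite foldr_rcons. Qed.

Lemma smooth_continuous f : smooth f -> continuous f.
Proof. by move=> sf x; apply/differentiable_continuous/smooth_differentiable. Qed.

Lemma differentiable_lin c f g x : differentiable f x -> differentiable g x ->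
  differentiable (fun x => c * f x + g x) x.
Proof.
move=> df dg; rewrite (_ : (fun x => _) = c *: f + g)//.
by apply: differentiableD => //; exact: differentiableZ.
Qed.

Lemma smooth_lin c f g : smooth f -> smooth g -> smooth (fun x => c * f x + g x).
Proof.
move=> sf sg s.
suff -> : foldr (@partial R n) (fun x => c * f x + g x) s =
    fun x => c * foldr (@partial R n) f s x + foldr (@partial R n) g s x.
  by move=> x; exact: differentiable_lin.
by elim: s => //= i s ->; rewrite partial_lin.
Qed.

Lemma partial_coord i j (x : E) : partial j (fun y => y ord0 i) x = (i == j)%:R.
Proof.
rewrite /partial deriveE; last exact: differentiable_coord.
(* The coordinate is packed as a linear map, so that it is its own differential. *)
have @f : {linear E -> R}.
  by exists (fun N : E => N ord0 i); do 2![eexists]; do ?[constructor];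
     rewrite ?mxE// => ? *; rewrite ?mxE//; move=> ?; rewrite !mxE.
rewrite (_ : (fun _ => _) = f)// diff_lin; last exact: coord_continuous.
by rewrite /f/= mxE eqxx.
Qed.

Lemma partial_coordM i j f : (forall x, differentiable f x) ->
  partial j (fun x => x ord0 i * f x) =
  fun x => x ord0 i * partial j f x + (i == j)%:R * f x.
Proof.
move=> df; apply/funext => x; rewrite /partial.
have dfx : derivable f x (delta_mx ord0 j) by apply: diff_derivable.
have dcx : derivable (fun y : E => y ord0 i) x (delta_mx ord0 j).
  by apply: diff_derivable; exact: differentiable_coord.
rewrite (_ : (fun y => _) = (fun y : E => y ord0 i) * f)// deriveM//.
congr (_ + _); rewrite mulrC -[RHS]/(f x *: _); congr (_ *: _).
exact: partial_coord.
Qed.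

(* Functions of the form [x_i f + g] with [f] and [g] smooth are stable under
   partial derivatives. *)
Lemma smooth_coordM i f : smooth f -> smooth (fun x => x ord0 i * f x).
Proof.
move=> sf s.
suff [h [k [sh sk ->]]] : exists h k, [/\ smooth h, smooth k &
    foldr (@partial R n) (fun x => x ord0 i * f x) s =
    fun x => 1 * (x ord0 i * h x) + k x].
  move=> x; apply: differentiable_lin; last exact: smooth_differentiable.
  apply: (@differentiableM _ _ (fun x : E => x ord0 i)).
    exact: differentiable_coord.
  exact: smooth_differentiable.
elim: s => [|j s [h [k [sh sk /= ->]]]].
  exists f, (fun=> 0); split => //.
    (* Zero is written as a combination of smooth functions to reuse [smooth_lin]. *)
    have -> : (fun=> 0) = (fun x => -1 * f x + f x).
      by apply/funext => x; rewrite mulN1r addNr.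
    exact: smooth_lin.
  by apply/funext => x /=; rewrite mul1r addr0.
exists (partial j h), (fun x => (i == j)%:R * h x + partial j k x); split.
- exact: smooth_partial.
- by apply: smooth_lin => //; exact: smooth_partial.
rewrite partial_lin; last 2 first.
- move=> x; apply: (@differentiableM _ _ (fun x : E => x ord0 i)).
    exact: differentiable_coord.
  exact: smooth_differentiable.
- exact: smooth_differentiable.
rewrite partial_coordM; last exact: smooth_differentiable.
by apply/funext => x; rewrite !mul1r addrA.
Qed.

Variable O : set E.

Lemma test_fun_lin c f g : test_fun O f -> test_fun O g ->
  test_fun O (fun x => c * f x + g x).
Proof.
move=> [sf cf fO] [sg cg gO].
have sub : closure [set x | c * f x + g x != 0] `<=`
    closure [set x | f x != 0] `|` closure [set x | g x != 0].
  have /closure_id -> :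
      closed (closure [set x | f x != 0] `|` closure [set x | g x != 0]).
    by apply: closedU; exact: closed_closure.
  apply: closure_subset => x /= fgx.
  have [fx|fx] := eqVneq (f x) 0; last by left; exact: subset_closure.
  by right; apply: subset_closure => /=; move: fgx; rewrite fx mulr0 add0r.
split; first exact: smooth_lin.
- by apply: subclosed_compact sub; [exact: closed_closure|exact: compactU].
- by apply: subset_trans sub _; rewrite subUset.
Qed.

Lemma test_fun_coordM i f : test_fun O f -> test_fun O (fun x => x ord0 i * f x).
Proof.
move=> [sf cf fO].
have sub : closure [set x : E | x ord0 i * f x != 0] `<=` closure [set x | f x != 0].
  by apply: closure_subset => x /=; rewrite mulf_eq0 negb_or => /andP[].
split; first exact: smooth_coordM.
- by apply: subclosed_compact sub; [exact: closed_closure|].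
- exact: subset_trans sub fO.
Qed.

End test_functions.

(** * The space H^1_0 and the Poincare inequality *)

Section sobolev.
Variables (R : realType) (n : nat) (O : set 'rV[R]_n).
Hypotheses (oO : open O) (bO : bounded_set O).
Local Notation E := 'rV[R]_n.
Local Notation mu := (lebesgue_rV R n).
Implicit Types (f g phi psi eta y v : E -> R) (Df Dg Dy Dv : 'I_n -> E -> R).

Let mO : measurable O. Proof. exact: open_rV_measurable. Qed.

Lemma continuous_L2 f : continuous f -> L2 O f.
Proof.
move=> cf; apply: bounded_L2 => //; first exact: bounded_rV_measure.
exact: continuous_bounded_coef.
Qed.

Lemma test_fun_L2 phi : test_fun O phi -> L2 O phi.
Proof. by move=> [sp _ _]; exact/continuous_L2/smooth_continuous. Qed.

Lemma test_fun_partial_L2 i phi : test_fun O phi -> L2 O (partial i phi).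
Proof.
by move=> [sp _ _]; apply/continuous_L2/smooth_continuous/smooth_partial.
Qed.

Lemma H1_lin c f g Df Dg : H1 O f Df -> H1 O g Dg ->
  H1 O (fun x => c * f x + g x) (fun i x => c * Df i x + Dg i x).
Proof.
move=> [Lf LDf wf] [Lg LDg wg]; split; first exact: L2_lin.
  by move=> i; exact: L2_lin.
move=> i phi tphi.
have Lp := test_fun_L2 tphi; have LDp := test_fun_partial_L2 i tphi.
by rewrite !L2ip_linl// wf// wg//; ring.
Qed.

(* [Df] is the gradient for which test functions approximate [f] in H^1. *)
Definition H10_grad f Df := H1 O f Df /\
  exists phi : nat -> E -> R, [/\ (forall k, test_fun O (phi k)),
    L2norm O (f \- phi k) @[k --> \oo] --> 0 &
    forall i, L2norm O (Df i \- partial i (phi k)) @[k --> \oo] --> 0].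

Lemma H1norm_ge f Df : L2norm O f <= H1norm O f Df.
Proof.
rewrite -[leLHS]ger0_norm ?L2norm_ge0// -sqrtr_sqr ler_wsqrtr// lerDl.
by apply: sumr_ge0 => i _; exact: sqr_ge0.
Qed.

Lemma H1norm_ge_grad i f Df : L2norm O (Df i) <= H1norm O f Df.
Proof.
rewrite -[leLHS]ger0_norm ?L2norm_ge0// -sqrtr_sqr ler_wsqrtr//.
rewrite (bigD1 i)//= addrCA lerDl addr_ge0 ?sqr_ge0//.
by apply: sumr_ge0 => j _; exact: sqr_ge0.
Qed.

(** [H1norm] dominates the norm of each component and is a continuous function of these norms.
    Componentwise convergence is the form in which limits are taken below. *)
Lemma H10_gradP f : H10 O f <-> exists Df, H10_grad f Df.
Proof.
split=> [[Df [Hf [phi [tphi cphi]]]]|[Df [Hf [phi [tphi cf cDf]]]]]; exists Df.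
  split=> //; exists phi; split=> // [|i].
    apply: squeeze_cvgr (cvg_cst 0) cphi; near=> k.
    by rewrite L2norm_ge0 H1norm_ge.
  apply: squeeze_cvgr (cvg_cst 0) cphi; near=> k.
  rewrite L2norm_ge0/=.
  exact: (@H1norm_ge_grad i _ (fun i => Df i \- partial i (phi k))).
split=> //; exists phi; split=> //.
rewrite /H1norm -[X in _ --> X]sqrtr0.
apply: (@continuous_cvg _ _ _ _ _ _ (@Num.sqrt R)); first exact: sqrt_continuous.
rewrite -[X in _ --> X]addr0; apply: cvgD.
  by rewrite -(mulr0 (0 : R)); under eq_fun do rewrite expr2; exact: cvgM.
have s0 : \sum_(i < n) (0 : R) = 0 by rewrite big1.
rewrite -[X in _ --> X]s0.
apply: cvg_big => [|i _]; first exact: add_continuous.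
by rewrite -(mulr0 (0 : R)); under eq_fun do rewrite expr2; exact: cvgM.
Unshelve. all: by end_near. Qed.

Lemma L2norm_lin_cvg0 c (f g : nat -> E -> R) :
    (forall k, L2 O (f k)) -> (forall k, L2 O (g k)) ->
    L2norm O (f k) @[k --> \oo] --> 0 -> L2norm O (g k) @[k --> \oo] --> 0 ->
  L2norm O (fun x => c * f k x + g k x) @[k --> \oo] --> 0.
Proof.
move=> Lf Lg cf cg.
have h0 : `|c| * L2norm O (f k) + L2norm O (g k) @[k --> \oo] --> 0.
  rewrite -(addr0 0) -{1}(mulr0 `|c|); apply: cvgD => //.
  by apply: cvgM => //; exact: cvg_cst.
apply: squeeze_cvgr (cvg_cst 0) h0; near=> k.
by rewrite L2norm_ge0 L2norm_lin.
Unshelve. all: by end_near. Qed.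

Lemma H10_grad_lin c f g Df Dg : H10_grad f Df -> H10_grad g Dg ->
  H10_grad (fun x => c * f x + g x) (fun i x => c * Df i x + Dg i x).
Proof.
move=> [Hf [phi [tphi cf cDf]]] [Hg [psi [tpsi cg cDg]]].
split; first exact: H1_lin.
have [Lf LDf _] := Hf; have [Lg LDg _] := Hg.
exists (fun k x => c * phi k x + psi k x); split => [k|| i].
- exact: test_fun_lin.
- under eq_fun => k.
    rewrite (_ : _ \- _ =
      fun x => c * (f \- phi k) x + (g \- psi k) x); last first.
      by apply/funext => x /=; ring.
    over.
  apply: L2norm_lin_cvg0 => // k; apply: L2_sub => //; exact: test_fun_L2.
- have sp k : forall x, differentiable (phi k) x.
    by have [? _ _] := tphi k; exact: smooth_differentiable.
  have sq k : forall x, differentiable (psi k) x.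
    by have [? _ _] := tpsi k; exact: smooth_differentiable.
  under eq_fun => k.
    rewrite partial_lin// (_ : _ \- _ = fun x =>
      c * (Df i \- partial i (phi k)) x + (Dg i \- partial i (psi k)) x); last first.
      by apply/funext => x /=; ring.
    over.
  apply: L2norm_lin_cvg0 => // k; apply: L2_sub => //; exact: test_fun_partial_L2.
Qed.

Lemma bounded_rV_coord :
  exists M : R, 0 <= M /\ forall i x, O x -> `|x ord0 i| <= M.
Proof.
have [M [_ bM]] := bO; exists (`|M| + 1); split=> [|i x Ox]; first by rewrite addr_ge0.
apply: le_trans (coord_le_norm _ _) (bM _ _ _ Ox).
by rewrite (le_lt_trans (ler_norm _))// ltrDl.
Qed.

Lemma bounded_coord i : bounded_coef O (fun x => x ord0 i).
Proof. by apply: continuous_bounded_coef => //; exact: coord_continuous. Qed.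

(* Testing the weak derivative with [x_i phi_k], where the test functions
   [phi_k] converge to [f] in H^1, and letting [k] tend to infinity. *)
Lemma H10_coordM i f Df : H10_grad f Df ->
  L2ip O f f = - (2 * L2ip O (fun x => x ord0 i * f x) (Df i)).
Proof.
move=> [[Lf LDf wf] [phi [tphi cf cDf]]].
have Lcf : L2 O (fun x => x ord0 i * f x) by apply: L2_coefM => //; exact: bounded_coord.
have LcD : L2 O (fun x => x ord0 i * Df i x) by apply: L2_coefM => //; exact: bounded_coord.
have swap g h : L2ip O (fun x => x ord0 i * g x) h = L2ip O g (fun x => x ord0 i * h x).
  by apply: eq_Rintegral => x _; rewrite mulrCA mulrA.
apply/eqP; rewrite -subr_eq0 opprK -normr_le0.
(* Cauchy-Schwarz bound for the error made by replacing [f] by [phi k]; the left-hand side of the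
   goal does not depend on [k]. *)
pose e k := L2norm O f * L2norm O (f \- phi k) +
  L2norm O (fun x => x ord0 i * f x) * L2norm O (Df i \- partial i (phi k)) +
  L2norm O (fun x => x ord0 i * Df i x) * L2norm O (f \- phi k).
have e0 : e k @[k --> \oo] --> 0.
  rewrite -(addr0 0); apply: cvgD; first rewrite -(addr0 0); first apply: cvgD.
  - by rewrite -(mulr0 (L2norm O f)); apply: cvgM => //; exact: cvg_cst.
  - rewrite -(mulr0 (L2norm O (fun x => x ord0 i * f x))).
    by apply: cvgM => //; exact: cvg_cst.
  - rewrite -(mulr0 (L2norm O (fun x => x ord0 i * Df i x))).
    by apply: cvgM => //; exact: cvg_cst.
apply: (ler_cvg_to (cvg_cst _) e0); near=> k.
have Lp := test_fun_L2 (tphi k); have LDp := test_fun_partial_L2 i (tphi k).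
have Lr : L2 O (f \- phi k) by exact: L2_sub.
have Ls : L2 O (Df i \- partial i (phi k)) by exact: L2_sub.
have sp : forall x, differentiable (phi k) x.
  by have [? _ _] := tphi k; exact: smooth_differentiable.
have LcDp : L2 O (fun x => x ord0 i * partial i (phi k) x).
  by apply: L2_coefM => //; exact: bounded_coord.
have := wf i _ (test_fun_coordM i (tphi k)); rewrite partial_coordM// eqxx.
rewrite (@L2ip_ext _ _ _ _ _ _ (fun x => 1 * phi k x + x ord0 i * partial i (phi k) x)
  (fun _ _ => erefl)); last by move=> x _ /=; ring.
rewrite L2ip_linr// -!swap => H.
have rE := L2ip_subr mO Lf Lp Lf.
have sE := L2ip_subr mO (LDf i) LDp Lcf.
have tE := L2ip_subr mO Lf Lp LcD.
have uE : L2ip O (fun x => x ord0 i * Df i x) f = L2ip O (fun x => x ord0 i * f x) (Df i).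
  by rewrite swap L2ipC.
(* The same three pairings taken with [phi k] and its derivative in place of the differences add up
   to zero by [H]. *)
rewrite (_ : _ + _ = L2ip O f (f \- phi k) +
  L2ip O (fun x => x ord0 i * f x) (Df i \- partial i (phi k)) +
  L2ip O (fun x => x ord0 i * Df i x) (f \- phi k)); last lra.
apply: (le_trans (ler_normD _ _)); apply: lerD; last exact: L2_CauchySchwarz.
by apply: (le_trans (ler_normD _ _)); apply: lerD; exact: L2_CauchySchwarz.
Unshelve. all: by end_near. Qed.

(** In the identity of [H10_coordM], Cauchy-Schwarz and $|x_i| \le M$ give $|f|^2 \le 2M |f| |D_i
    f|$; divide by $|f|$. One partial derivative suffices. *)
Lemma poincare i : exists K : R, 0 <= K /\
  forall f Df, H10_grad f Df -> L2norm O f <= K * L2norm O (Df i).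
Proof.
have [M [M0 bM]] := bounded_rV_coord.
exists (2 * M); split=> [|f Df Hf]; first by rewrite mulr_ge0.
have [[Lf LDf _] _] := Hf; have [mc _] := bounded_coord i.
have Lcf : L2 O (fun x => x ord0 i * f x) by apply: L2_coefM => //; exact: bounded_coord.
have [f0|f0] := eqVneq (L2norm O f) 0.
  by rewrite f0 !mulr_ge0// L2norm_ge0.
have fp : 0 < L2norm O f by rewrite lt_neqAle eq_sym f0 L2norm_ge0.
rewrite -(ler_pM2l fp) -expr2 L2norm_sqr (H10_coordM i Hf).
have := L2_CauchySchwarz mO Lcf (LDf i).
have : L2norm O (fun x => x ord0 i * f x) * L2norm O (Df i) <=
    M * L2norm O f * L2norm O (Df i).
  by rewrite ler_wpM2r ?L2norm_ge0// L2norm_coefM// => x; exact: bM.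
by rewrite ler_norml => h /andP[]; lra.
Qed.

End sobolev.

(** * The elliptic problem: coercivity, a priori bound, linearity of the solution operator *)

Section elliptic.
Variables (R : realType) (n : nat) (O : set 'rV[R]_n).
Hypotheses (oO : open O) (bO : bounded_set O).
Local Notation E := 'rV[R]_n.
Local Notation mu := (lebesgue_rV R n).
Implicit Types (f g eta y z v : E -> R) (Df Dg Dy Dz Dv : 'I_n -> E -> R).

Let mO : measurable O. Proof. exact: open_rV_measurable. Qed.

Lemma Rintegral_sum I (r : seq I) (F : I -> E -> R) :
    (forall i, mu.-integrable O (EFin \o F i)) ->
  mu.-integrable O (EFin \o (fun x => \sum_(i <- r) F i x)) /\
  \int[mu]_(x in O) (\sum_(i <- r) F i x) = \sum_(i <- r) \int[mu]_(x in O) F i x.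
Proof.
move=> iF; elim: r => [|i r [ir Er]].
  have E0 : (fun x => \sum_(i <- [::]) F i x) = cst 0.
    by apply/funext => x; rewrite big_nil.
  rewrite E0; split; first exact: integrable0.
  by rewrite big_nil Rintegral_cst// mul0r.
have E0 : (fun x => \sum_(i <- i :: r) F i x) = F i \+ (fun x => \sum_(i <- r) F i x).
  by apply/funext => x; rewrite big_cons.
rewrite E0; split; first exact: (integrableD mO (iF i) ir).
by rewrite big_cons -Er RintegralD.
Qed.

(** Truncating [a0] changes it only on a null set, hence changes no integral, and makes the bound
    and the sign hold pointwise. *)
Lemma Linfty_bounded_coef a0 : Linfty O a0 -> {ae mu, forall x, O x -> 0 <= a0 x} ->
  exists b, [/\ bounded_coef O b, forall x, 0 <= b x &
    forall z v, L2 O z -> L2 O v ->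
      \int[mu]_(x in O) (a0 x * z x * v x) = L2ip O (fun x => b x * z x) v].
Proof.
move=> [ma0 [M aM]] a00.
(* [M] itself could be negative when [O] is null; [|M|] keeps [b] nonnegative. *)
pose b x := Num.min `|M| (Num.max 0 (a0 x)).
have mb : measurable_fun O b.
  apply: measurable_minr; first exact: measurable_cst.
  by apply: measurable_maxr => //; exact: measurable_cst.
have b0 x : 0 <= b x by rewrite le_min normr_ge0 le_max lexx.
exists b; split => // [|z v [mz _] [mv _]].
  split => //; exists `|M|; split => // x _.
  by rewrite ger0_norm// ge_min lexx.
congr fine; apply: ae_eq_integral => //.
- by apply/measurable_EFinP/measurable_funM => //; exact: measurable_funM.
- by apply/measurable_EFinP/measurable_funM => //; exact: measurable_funM.
apply: filterS2 aM a00 => x aM a00 Ox; congr (_ * _ * _)%:E.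
rewrite /b max_r ?a00// min_r// (le_trans (ler_norm _))// (le_trans (aM Ox))//.
exact: ler_norm.
Qed.

Variables (A : 'I_n -> 'I_n -> E -> R) (a0 : E -> R).
Hypothesis coefA : coefficients O A a0.

Lemma coefficients_bounded i j : bounded_coef O (A i j).
Proof.
have [_ _ lA _ _] := coefA; apply: lipschitz_bounded_coef => //.
apply: sub_lipschitz (lA i j) => P /= PO -[x y] /= [Ox Oy].
by apply: PO; split; exact: subset_closure.
Qed.

Lemma bilin_lin c z1 Dz1 z2 Dz2 v Dv :
  L2 O z1 -> (forall i, L2 O (Dz1 i)) -> L2 O z2 -> (forall i, L2 O (Dz2 i)) ->
  L2 O v -> (forall i, L2 O (Dv i)) ->
  bilin O A a0 (fun x => c * z1 x + z2 x) (fun i x => c * Dz1 i x + Dz2 i x) v Dv =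
  c * bilin O A a0 z1 Dz1 v Dv + bilin O A a0 z2 Dz2 v Dv.
Proof.
move=> Lz1 LD1 Lz2 LD2 Lv LDv; have [la0 a00 _ _ _] := coefA.
have [b [bb _ bE]] := Linfty_bounded_coef la0 a00.
rewrite /bilin !bE//; last exact: L2_lin.
rewrite (@L2ip_ext _ _ _ _ (fun x => c * (b x * z1 x) + b x * z2 x) v v) => //; last first.
  by move=> x _; ring.
rewrite L2ip_linl//; [|exact: L2_coefM|exact: L2_coefM].
rewrite mulrDr addrACA mulr_sumr -big_split/=; congr (_ + _).
apply: eq_bigr => i _; rewrite mulr_sumr -big_split/=; apply: eq_bigr => j _.
have bA := coefficients_bounded i j.
have := @L2ip_linl _ _ _ mO c _ _ (Dv j) (L2_coefM mO bA (LD1 i))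
  (L2_coefM mO bA (LD2 i)) (LDv j).
by rewrite /L2ip => <-; apply: eq_Rintegral => x _; ring.
Qed.

(** Ellipticity at $\xi = Dz(x)$ is integrated over [O]; the zeroth order term is nonnegative and is
    dropped. *)
Lemma bilin_coercive : exists alpha : R, 0 < alpha /\
  forall z Dz, L2 O z -> (forall i, L2 O (Dz i)) ->
    alpha * (\sum_i L2norm O (Dz i) ^+ 2) <= bilin O A a0 z Dz z Dz.
Proof.
have [la0 a00 _ _ [alpha [alpha0 ell]]] := coefA.
exists alpha; split=> // z Dz Lz LD.
have [b [bb b0 bE]] := Linfty_bounded_coef la0 a00.
rewrite /bilin bE// -[leLHS]addr0; apply: lerD; last first.
  by apply: Rintegral_ge0 => x _; rewrite -mulrA -expr2 mulr_ge0// sqr_ge0.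
have iA i j : mu.-integrable O (EFin \o (fun x => A i j x * Dz i x * Dz j x)).
  exact: (L2_integrableM mO (L2_coefM mO (coefficients_bounded i j) (LD i)) (LD j)).
have iD i : mu.-integrable O (EFin \o (fun x => Dz i x * Dz i x)).
  exact: L2_integrableM.
under eq_bigr do rewrite L2norm_sqr.
have [isD <-] := Rintegral_sum (index_enum _) iD.
rewrite -RintegralZl//.
under [leRHS]eq_bigr => i _ do rewrite -(Rintegral_sum (index_enum _) (iA i)).2.
have isA i := (Rintegral_sum (index_enum _) (iA i)).1.
have [issA <-] := Rintegral_sum (index_enum _) isA.
apply: le_Rintegral => //; first exact: (integrableZl mO alpha isD).
move=> x Ox; have := ell x Ox (\row_i Dz i x).
rewrite (eq_bigr (fun i => Dz i x * Dz i x)) => [|i _]; last by rewrite mxE -expr2.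
move=> /le_trans; apply.
by apply: ler_sum => i _; apply: ler_sum => j _; rewrite !mxE.
Qed.

(* [weak_solution] tests the equation for every representative of the gradient;
   fixing one makes linearity in [(eta, y)] immediate. *)
Definition weak_sol eta y := exists Dy, H10_grad O y Dy /\
  forall v Dv, H10_grad O v Dv -> bilin O A a0 y Dy v Dv = L2ip O eta v.

Lemma weak_solutionW eta y : weak_solution O A a0 eta y -> weak_sol eta y.
Proof.
move=> [/H10_gradP[Dy HDy] sol]; exists Dy; split=> // v Dv HDv.
by apply: sol; [apply/H10_gradP; exists Dv|exact: HDy.1|exact: HDv.1].
Qed.

Lemma weak_sol_lin c eta1 eta2 y1 y2 : L2 O eta1 -> L2 O eta2 ->
    weak_sol eta1 y1 -> weak_sol eta2 y2 ->
  weak_sol (fun x => c * eta1 x + eta2 x) (fun x => c * y1 x + y2 x).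
Proof.
move=> L1 L2' [D1 [H1 s1]] [D2 [H2 s2]].
exists (fun i x => c * D1 i x + D2 i x); split; first exact: H10_grad_lin.
move=> v Dv Hv; have [[Lv LDv _] _] := Hv.
have [[Ly1 LD1 _] _] := H1; have [[Ly2 LD2 _] _] := H2.
by rewrite bilin_lin// L2ip_linl// s1// s2.
Qed.

Hypothesis n_gt0 : (0 < n)%N.

(* Coercivity bounds [|Dy|^2] by [|eta| |y|], and Poincare turns this into a
   bound on [|y|]. *)
Lemma weak_sol_bound : exists K : R, 0 <= K /\ forall eta y, L2 O eta -> weak_sol eta y ->
  exists Dy, [/\ H10_grad O y Dy, L2norm O y <= K * L2norm O eta &
    H1norm O y Dy <= K * L2norm O eta].
Proof.
have [P [P0 poin]] := poincare oO bO (Ordinal n_gt0).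
have [alpha [alpha0 coer]] := bilin_coercive.
(* From $|y|^2 \le P^2 G$ and $\alpha G \le |\eta| |y|$, where $G = |Dy|^2$, follows $|y| \le K
   |\eta|$. *)
pose K := P ^+ 2 / alpha; have K0 : 0 <= K by rewrite divr_ge0 ?sqr_ge0 ?ltW.
have K10 : 0 <= K ^+ 2 + K / alpha.
  by rewrite addr_ge0 ?sqr_ge0// divr_ge0// ltW.
(* Sum of $|y|^2 \le K^2 |\eta|^2$ and $|Dy|^2 \le (K/\alpha) |\eta|^2$. *)
exists (Num.sqrt (K ^+ 2 + K / alpha)); split; first exact: sqrtr_ge0.
move=> eta y Leta [Dy [Hy sol]]; exists Dy.
have [[Ly LD _] _] := Hy.
set N := L2norm O eta; have N0 : 0 <= N by exact: L2norm_ge0.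
pose G := \sum_i L2norm O (Dy i) ^+ 2.
have yG : L2norm O y ^+ 2 <= P ^+ 2 * G.
  apply: (@le_trans _ _ ((P * L2norm O (Dy (Ordinal n_gt0))) ^+ 2)).
    by rewrite ler_pXn2r ?nnegrE ?mulr_ge0 ?L2norm_ge0// poin.
  rewrite exprMn ler_wpM2l ?sqr_ge0// /G (bigD1 (Ordinal n_gt0))//= lerDl.
  by apply: sumr_ge0 => i _; exact: sqr_ge0.
have GN : alpha * G <= N * L2norm O y.
  apply: (le_trans (coer _ _ Ly LD)); rewrite sol//.
  exact: le_trans (ler_norm _) (L2_CauchySchwarz mO Leta Ly).
have y0 := L2norm_ge0 O y.
have yK : L2norm O y <= K * N.
  have [->|yn0] := eqVneq (L2norm O y) 0; first exact: mulr_ge0.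
  have yp : 0 < L2norm O y by rewrite lt_neqAle eq_sym yn0.
  rewrite -(ler_pM2r yp) -expr2; apply: (le_trans yG).
  rewrite /K -(ler_pM2l alpha0).
  have -> : alpha * (P ^+ 2 / alpha * N * L2norm O y) = P ^+ 2 * (N * L2norm O y).
    by field; rewrite gt_eqF.
  by rewrite mulrCA ler_wpM2l ?sqr_ge0.
have GK : G <= K / alpha * N ^+ 2.
  rewrite -(ler_pM2l alpha0) (le_trans GN)//.
  have -> : alpha * (K / alpha * N ^+ 2) = N * (K * N) by field; rewrite gt_eqF.
  by rewrite ler_wpM2l.
have yK2 : L2norm O y ^+ 2 <= K ^+ 2 * N ^+ 2.
  by rewrite -exprMn ler_pXn2r ?nnegrE// mulr_ge0.
have HK : H1norm O y Dy <= Num.sqrt (K ^+ 2 + K / alpha) * N.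
  rewrite -[leRHS]ger0_norm; last by rewrite mulr_ge0// sqrtr_ge0.
  rewrite -sqrtr_sqr /H1norm ler_wsqrtr// exprMn (sqr_sqrtr K10) mulrDl -/G.
  exact: lerD.
by split => //; apply: le_trans HK; exact: H1norm_ge.
Qed.

Variable S : (E -> R) -> E -> R.
Hypothesis S_op : solution_operator O A a0 S.

Lemma solution_operator_weak_sol eta : L2 O eta -> weak_sol eta (S eta).
Proof. by move=> /S_op[_ /weak_solutionW]. Qed.

Lemma solution_operator_L2 eta : L2 O eta -> L2 O (S eta).
Proof. by move=> /solution_operator_weak_sol[Dy [[[]]]]. Qed.

Lemma solution_operator_continuous eta : L2 O eta ->
  forall x, O x -> {for x, continuous (S eta)}.
Proof.
move=> /S_op[[cS _] _] x Ox.
have : {within O, continuous (S eta)}.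
  by apply: continuous_subspaceW cS; exact: subset_closure.
by rewrite continuous_open_subspace// => /(_ x); rewrite inE; apply.
Qed.

(** The difference of the two sides is a weak solution with datum zero, so its L^2 norm vanishes by
    [weak_sol_bound]. Being continuous on [O], it is zero at every point, as point evaluation
    demands. *)
Lemma solution_operator_lin c eta1 eta2 : L2 O eta1 -> L2 O eta2 ->
  forall x, O x ->
  S (fun x => c * eta1 x + eta2 x) x = c * S eta1 x + S eta2 x.
Proof.
move=> L1 L2'.
have L12 : L2 O (fun x => c * eta1 x + eta2 x) by exact: L2_lin.
have w12 := weak_sol_lin c L1 L2' (solution_operator_weak_sol L1)
  (solution_operator_weak_sol L2').
have := weak_sol_lin (-1) L12 L12 (solution_operator_weak_sol L12) w12.
have -> : (fun x => -1 * (c * eta1 x + eta2 x) + (c * eta1 x + eta2 x)) = fun=> 0.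
  by apply/funext => x; ring.
set d := (fun x => _ + _) => wd x Ox.
have [K [_ /(_ _ _ (L2_0 O) wd)[Dd [Hd + _]]]] := weak_sol_bound.
rewrite (L2norm0 mO) mulr0 => d0.
have : d x = 0.
  apply: (L2norm_eq0_continuous oO _ _ _ Ox).
  - by have [[]] := Hd.
  - move=> y Oy; have cSy eta : L2 O eta -> S eta @ y --> S eta y.
      by move=> Leta; exact: solution_operator_continuous.
    exact: (cvgD (cvgM (cvg_cst _) (cSy _ L12))
      (cvgD (cvgM (cvg_cst _) (cSy _ L1)) (cSy _ L2'))).
  - by apply/eqP; rewrite eq_le d0 L2norm_ge0.
by rewrite /d; lra.
Qed.

End elliptic.

(** * Corrections matching finitely many linear functionals *)

(* No continuity of the functionals [T w] is needed. The induction on [s] must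
   quantify over [p]: adding a functional [T w] replaces [p] by
   [p + k |T w|]. *)
Lemma finite_rank_correction (R : realType) (X : lmodType R) (V : set X)
    (W : eqType) (T : W -> X -> R) (s : seq W) :
  V 0 -> (forall c f g, V f -> V g -> V (c *: f + g)) ->
  (forall w, w \in s ->
    forall c f g, V f -> V g -> T w (c *: f + g) = c * T w f + T w g) ->
  forall p : X -> R, p 0 = 0 ->
  (forall c f g, V f -> V g -> p (c *: f + g) <= `|c| * p f + p g) ->
  (forall f, V f -> 0 <= p f) ->
  exists C : R, 0 <= C /\ forall f, V f -> exists r, [/\ V r,
    forall w, w \in s -> T w r = T w f & p r <= C * \sum_(w <- s) `|T w f|].
Proof.
move=> V0 VL; elim: s => [|w s IH] TL p p0 pL pge0.
  exists 0; split => // f Vf; exists 0; split => //.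
  by rewrite p0 mul0r.
have {}IH := IH (fun w' ws => TL w' (@mem_behead _ (w :: s) w' ws)).
have TwL := TL w (mem_head _ _).
have Tw0 : T w 0 = 0.
  by have := TwL 1 0 0 V0 V0; rewrite scaler0 addr0; lra.
(* Either [T w] vanishes on the common kernel of the functionals in [s], and a correction for [s]
   already matches [T w], or some [e] in that kernel adjusts [T w] alone. *)
have [H|/existsNP[e /not_implyP[Ve /not_implyP[Te /eqP Twe]]]] := pselect
    (forall e, V e -> (forall w', w' \in s -> T w' e = 0) -> T w e = 0).
  have [C [C0 IHC]] := IH p p0 pL pge0; exists C; split=> // f Vf.
  have [r [Vr Tr pr]] := IHC f Vf; exists r; split => // [w'|].
    rewrite inE => /predU1P[->|]; last exact: Tr.
    have : T w (-1 *: f + r) = 0.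
      apply: H => [|w'' ws]; first exact: VL.
      by rewrite TL ?inE ?ws ?orbT// Tr//; lra.
    by rewrite TwL//; lra.
  by apply: (le_trans pr); rewrite big_cons ler_wpM2l// lerDr.
(* The cost in [p] of changing [T w] by one unit along [e]. *)
pose k := p e / `|T w e|.
have k0 : 0 <= k by rewrite divr_ge0// pge0.
pose q f := p f + `|T w f| * k.
have [||f Vf|C [C0 IHC]] := IH q.
- by rewrite /q p0 Tw0 normr0 mul0r addr0.
- move=> c f g Vf Vg; rewrite /q TwL//.
  have := pL c f g Vf Vg.
  have : `|c * T w f + T w g| * k <= (`|c| * `|T w f| + `|T w g|) * k.
    by rewrite ler_wpM2r// -normrM ler_normD.
  lra.
- by rewrite /q addr_ge0 ?mulr_ge0// pge0.
exists (C + k); split=> [|f Vf]; first exact: addr_ge0.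
have [r [Vr Tr qr]] := IHC f Vf.
(* This [c] makes [T w] agree with its value at [f]. The cost is at most $k |T_w f| + k |T_w r| +
   p(r)$, and the last two terms form $q(r)$. *)
pose c := (T w f - T w r) / T w e.
exists (c *: e + r); split=> [|w'|]; first exact: VL.
  rewrite inE => /predU1P[->|ws]; first by rewrite TwL// /c divfK//; lra.
  by rewrite TL ?inE ?ws ?orbT// Te// mulr0 add0r Tr.
apply: (le_trans (pL _ _ _ Ve Vr)).
have -> : `|c| * p e = `|T w f - T w r| * k.
  by rewrite /c /k normrM normfV mulrAC mulrA.
have : `|T w f - T w r| * k <= (`|T w f| + `|T w r|) * k.
  by rewrite ler_wpM2r// ler_normB.
have S0 : 0 <= \sum_(w <- s) `|T w f| by exact: sumr_ge0.
have := mulr_ge0 k0 S0; have := mulr_ge0 C0 (normr_ge0 (T w f)).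
move: qr; rewrite /q big_cons; nra.
Qed.

(** * The optimal control problems: strong convexity, perturbation, rate of convergence *)

Section optimal_control.
Variables (R : realType) (n : nat) (O : set 'rV[R]_n).
Hypotheses (oO : open O) (bO : bounded_set O) (n_gt0 : (0 < n)%N).
Local Notation E := 'rV[R]_n.
Variables (A : 'I_n -> 'I_n -> E -> R) (a0 : E -> R) (S : (E -> R) -> E -> R).
Hypotheses (coefA : coefficients O A a0) (S_op : solution_operator O A a0 S).
Variables (theta : R) (gd : E -> R).
Hypotheses (theta_ge0 : 0 <= theta) (gdL2 : L2 O gd).

Let mO : measurable O. Proof. exact: open_rV_measurable. Qed.
Let S_L2 eta : L2 O eta -> L2 O (S eta). Proof. exact: (solution_operator_L2 S_op). Qed.

Let L2_linZ c f g : L2 O f -> L2 O g -> L2 O (c *: f + g).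
Proof. exact: (L2_lin mO). Qed.

Let S_lin c f g x : L2 O f -> L2 O g -> O x -> S (c *: f + g) x = c * S f x + S g x.
Proof.
by move=> Lf Lg; exact: (solution_operator_lin oO bO coefA n_gt0 S_op c Lf Lg).
Qed.

(** Linearity of [S] on [O] makes the reduced cost a quadratic polynomial in [c]. *)
Lemma J_lin c f g : L2 O f -> L2 O g ->
  J O theta gd (S (c *: f + g)) (c *: f + g) =
  theta / 2 * (c ^+ 2 * L2norm O (S f) ^+ 2 + 2 * c * L2ip O (S f) (S g \- gd) +
    L2norm O (S g \- gd) ^+ 2) +
  (c ^+ 2 * L2norm O f ^+ 2 + 2 * c * L2ip O f g + L2norm O g ^+ 2) / 2.
Proof.
move=> Lf Lg; rewrite /J !L2norm_sqr.
rewrite (@L2ip_ext _ _ _ (S (c *: f + g) \- gd) (fun x => c * S f x + (S g \- gd) x)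
    _ (fun x => c * S f x + (S g \- gd) x)); last 2 first.
- by move=> x Ox /=; rewrite S_lin//; ring.
- by move=> x Ox /=; rewrite S_lin//; ring.
rewrite !L2ip_sqr_lin//; [exact: S_L2|].
by apply: L2_sub => //; exact: S_L2.
Qed.

(* The midpoint of [ubar] and [w + ubar] is feasible; compare its cost with that
   of [ubar]. *)
Lemma J_strongly_convex (I : set E) g ubar w : I `<=` O -> L2 O w ->
    (forall x, I x -> S w x = 0) ->
    minimises (feasible O S I g) (J O theta gd) (S ubar) ubar ->
  L2norm O w ^+ 2 <=
  4 * (J O theta gd (S (1 *: w + ubar)) (1 *: w + ubar) -
       J O theta gd (S ubar) ubar).
Proof.
move=> IO Lw Sw [[_ Lu _ ug] min].
have Lm : L2 O (2^-1 *: w + ubar) by exact: L2_linZ.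
have : feasible O S I g (S (2^-1 *: w + ubar)) (2^-1 *: w + ubar).
  split=> // [|x Ix]; first by have [_ []] := S_op Lm.
  by rewrite (S_lin _ Lw Lu (IO _ Ix)) Sw// mulr0 add0r ug.
move=> /min.
have -> : J O theta gd (S ubar) ubar = theta / 2 * L2norm O (S ubar \- gd) ^+ 2 +
  L2norm O ubar ^+ 2 / 2 by [].
(* The cost at $\bar u + c w$ is $a c^2 + b c + J(\bar u)$ with $a \ge |w|^2/2$. Minimality against
   $c = 1/2$ gives $b \ge -a/2$, so the increment at $c = 1$ is at least $a/2$. *)
rewrite !J_lin//.
have := mulr_ge0 theta_ge0 (sqr_ge0 (L2norm O (S w))).
lra.
Qed.

(** Cross terms are bounded by Cauchy-Schwarz and $t \le (1 + t^2)/2$; the squares thus produced are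
    collected in [d] times the cost of [u]. *)
Lemma J_perturb r u d : L2 O r -> L2 O u -> L2norm O r <= d -> L2norm O (S r) <= d ->
  J O theta gd (S (1 *: r + u)) (1 *: r + u) <= J O theta gd (S u) u +
    ((theta + 1) / 2 * (d ^+ 2 + d) + d * J O theta gd (S u) u).
Proof.
move=> Lr Lu rd Sd; rewrite J_lin//.
have LSr := S_L2 Lr; have Lb : L2 O (S u \- gd) by apply: L2_sub => //; exact: S_L2.
rewrite /J; have := L2_CauchySchwarz mO Lr Lu; have := L2_CauchySchwarz mO LSr Lb.
have := L2norm_ge0 O r; have := L2norm_ge0 O (S r).
have := L2norm_ge0 O u; have := L2norm_ge0 O (S u \- gd).
set B := L2norm O (S u \- gd); set U := L2norm O u.
set x := L2norm O r in rd *; set y := L2norm O (S r) in Sd *.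
move=> B0 U0 y0 x0 h1 h2.
have d0 : 0 <= d by exact: le_trans x0 rd.
have H1 : L2ip O (S r) (S u \- gd) <= d * ((1 + B ^+ 2) / 2).
  apply: (le_trans (ler_norm _)); apply: (le_trans h1); apply: ler_pM => //.
  by have := sqr_ge0 (1 - B); nra.
have H2 : L2ip O r u <= d * ((1 + U ^+ 2) / 2).
  apply: (le_trans (ler_norm _)); apply: (le_trans h2); apply: ler_pM => //.
  by have := sqr_ge0 (1 - U); nra.
have y2 : y ^+ 2 <= d ^+ 2 by rewrite ler_pXn2r ?nnegrE.
have x2 : x ^+ 2 <= d ^+ 2 by rewrite ler_pXn2r ?nnegrE.
have := ler_wpM2l theta_ge0 H1; have := ler_wpM2l theta_ge0 y2.
lra.
Qed.

Lemma J_ge0 y eta : 0 <= J O theta gd y eta.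
Proof.
apply: addr_ge0; last by rewrite divr_ge0// sqr_ge0.
by rewrite mulr_ge0 ?sqr_ge0// divr_ge0.
Qed.

(** The finite rank correction is applied with $p(f) = |f| + |Sf|$, which makes [r] and [S r] small
    together. *)
Lemma S_correction (s : seq E) : (forall w, w \in s -> O w) ->
  exists C : R, 0 <= C /\ forall f, L2 O f -> exists r, [/\ L2 O r,
    forall w, w \in s -> S r w = S f w,
    L2norm O r <= C * \sum_(w <- s) `|S f w| &
    L2norm O (S r) <= C * \sum_(w <- s) `|S f w|].
Proof.
move=> sO; have L0 : L2 O 0 by exact: L2_0.
have S0 x : O x -> S 0 x = 0.
  by move=> Ox; have := S_lin 1 L0 L0 Ox; rewrite scaler0 addr0; lra.
have [] := @finite_rank_correction R (E -> R) (L2 O) E (fun w f => S f w) s L0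
  L2_linZ (fun w ws c f g Lf Lg => S_lin c Lf Lg (sO w ws))
  (fun f => L2norm O f + L2norm O (S f)).
- by rewrite (L2norm_ext S0) [X in X + _](L2norm0 mO) (L2norm0 mO) addr0.
- move=> c f g Lf Lg; rewrite mulrDr addrACA lerD//; first exact: L2norm_lin.
  rewrite (@L2norm_ext _ _ _ _ (fun x => c * S f x + S g x)) => [|x Ox].
    by apply: L2norm_lin => //; exact: S_L2.
  exact: S_lin.
- by move=> f _; rewrite addr_ge0 ?L2norm_ge0.
move=> C [C0 HC]; exists C; split=> // f /HC[r [Lr Tr pr]]; exists r.
have := L2norm_ge0 O r; have := L2norm_ge0 O (S r).
by split=> //; lra.
Qed.

(** The modulus [h] constructed here is $O(\nu^{1/4})$: the correction costs $O(\sqrt\nu)$ in norm,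
    and strong convexity takes the square root of an excess cost $O(\sqrt\nu)$. *)
Lemma control_cvg (I : set E) g (u : R -> E -> R) ubar :
    finite_set I -> I `<=` O ->
    (forall nu, 0 < nu ->
      minimises (feasible_nu O S) (Jnu O I g theta nu gd) (S (u nu)) (u nu)) ->
    minimises (feasible O S I g) (J O theta gd) (S ubar) ubar ->
  exists h : R -> R, h nu @[nu --> 0^'+] --> 0 /\
    forall nu, 0 < nu -> L2norm O (-1 *: ubar + u nu) <= h nu.
Proof.
move=> finI IO umin ubarmin.
have [s us Is] : exists2 s : seq E, uniq s & I = [set` s].
  have /finite_seqP[s Is] := finI; exists (undup s); first exact: undup_uniq.
  by rewrite Is; apply/seteqP; split => x /=; rewrite mem_undup.
have sO w : w \in s -> O w by move=> ws; apply: IO; rewrite Is.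
have [[_ Lub _ ubg] ubmin] := ubarmin.
have [C [C0 HC]] := S_correction sO.
set Jb := J O theta gd (S ubar) ubar; have Jb0 : 0 <= Jb by exact: J_ge0.
(* [d] bounds the correction and its image: each point of [s] contributes a residual of at most
   $\sqrt{2 J(\bar u)\nu}$. [e] is four times the excess in [J_perturb], with $J(u_\nu)$ replaced by
   its bound [Jb]. *)
pose d nu := C * ((size s)%:R * Num.sqrt (2 * Jb)) * Num.sqrt nu.
pose e nu := 4 * ((theta + 1) / 2 * (d nu ^+ 2 + d nu) + d nu * Jb).
exists (fun nu => d nu + Num.sqrt (e nu)); split.
  have d0 : d nu @[nu --> 0^'+] --> 0.
    rewrite -[X in _ --> X](mulr0 (C * ((size s)%:R * Num.sqrt (2 * Jb)))).
    apply: cvgM; first exact: cvg_cst.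
    rewrite -[X in _ --> X]sqrtr0.
    exact: (cvg_at_right_filter (@sqrt_continuous R 0)).
  rewrite -[X in _ --> X](addr0 0); apply: cvgD => //; rewrite -[X in _ --> X]sqrtr0.
  apply: (@continuous_cvg _ _ _ _ _ _ (@Num.sqrt R)); first exact: sqrt_continuous.
  have e0 : 4 * ((theta + 1) / 2 * (0 * 0 + 0) + 0 * Jb) = 0 :> R by ring.
  rewrite -[X in _ --> X]e0.
  apply: cvgM; first exact: cvg_cst.
  apply: cvgD; last by apply: cvgM => //; exact: cvg_cst.
  apply: cvgM; first exact: cvg_cst.
  by apply: cvgD => //; under eq_fun do rewrite expr2; exact: cvgM.
move=> nu nu0.
have [[_ Lu _] unu] := umin nu nu0.
have fsb (F : E -> R) : \sum_(w \in I) F w = \sum_(w <- s) F w.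
  by rewrite Is -fsbig_seq.
have opt : 1 / 2 * (\sum_(w <- s) (S (u nu) w - g w) ^+ 2) +
    nu * J O theta gd (S (u nu)) (u nu) <= nu * Jb.
  have : feasible_nu O S (S ubar) ubar.
    by split=> //; have [] := S_op Lub.
  move=> /unu; rewrite /Jnu !fsb [X in _ <= 1 / 2 * X + _]big1_seq ?mulr0 ?add0r//.
  by move=> w /andP[_ ws]; rewrite ubg ?Is//= subrr expr0n.
have JuJb : J O theta gd (S (u nu)) (u nu) <= Jb.
  rewrite -(ler_pM2l nu0); apply: le_trans opt; rewrite lerDr mulr_ge0//.
  by apply: sumr_ge0 => w _; exact: sqr_ge0.
have res w : w \in s -> `|g w - S (u nu) w| <= Num.sqrt (2 * Jb) * Num.sqrt nu.
  move=> ws; rewrite -sqrtrM ?mulr_ge0// -sqrtr_sqr ler_wsqrtr//.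
  have : (S (u nu) w - g w) ^+ 2 <= \sum_(w <- s) (S (u nu) w - g w) ^+ 2.
    by rewrite (big_rem w ws)/= lerDl; apply: sumr_ge0 => v _; exact: sqr_ge0.
  have := mulr_ge0 (ltW nu0) (J_ge0 (S (u nu)) (u nu)).
  by move: opt; lra.
(* Its state has the residuals of [u nu] as point values, since that of [ubar] interpolates [g]. *)
have Lf : L2 O (-1 *: u nu + ubar) by exact: L2_linZ.
have [r [Lr Tr rd Srd]] := HC _ Lf.
have dE : C * (\sum_(w <- s) `|S (-1 *: u nu + ubar) w|) <= d nu.
  rewrite /d -mulrA ler_wpM2l// -mulrA.
  apply: (@le_trans _ _ (\sum_(w <- s) Num.sqrt (2 * Jb) * Num.sqrt nu)); last first.
    by rewrite big_const_seq count_predT iter_addr_0 -[leLHS]mulr_natl.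
  rewrite big_seq [leRHS]big_seq; apply: ler_sum => w ws.
  by rewrite (S_lin _ Lu Lub (sO w ws)) ubg ?Is// mulN1r addrC res.
have {}rd := le_trans rd dE; have {}Srd := le_trans Srd dE.
(* [eta] is [u nu] moved onto the interpolation constraint; the state of [w], its difference to
   [ubar], vanishes on [I]. *)
pose eta := 1 *: r + u nu; have Leta : L2 O eta by exact: L2_linZ.
pose w := -1 *: ubar + eta; have Lw : L2 O w by exact: L2_linZ.
have Sw x : I x -> S w x = 0.
  move=> Ix; have Ox := IO x Ix.
  rewrite (S_lin _ Lub Leta Ox) (S_lin _ Lr Lu Ox) Tr; last by move: Ix; rewrite Is.
  by rewrite (S_lin _ Lu Lub Ox); ring.
have := J_strongly_convex IO Lw Sw ubarmin.
have -> : 1 *: w + ubar = eta.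
  by rewrite /w scale1r scaleN1r addrC addrA subrr add0r.
have Jeta := J_perturb Lr Lu rd Srd.
have d0 : 0 <= d nu by exact: le_trans (L2norm_ge0 _ _) rd.
move=> w2.
have {}w2 : L2norm O w ^+ 2 <= e nu.
  apply: (le_trans w2); rewrite -/Jb /e ler_pM2l//.
  have := ler_wpM2l d0 JuJb; move: Jeta; rewrite -/eta; lra.
have -> : -1 *: ubar + u nu = -1 *: r + w.
  by rewrite /w /eta scale1r !scaleN1r (addrCA (- r)) addKr.
apply: (le_trans (L2norm_lin mO (-1) Lr Lw)).
rewrite normrN1 mul1r lerD// -[leLHS]ger0_norm ?L2norm_ge0// -sqrtr_sqr.
exact: ler_wsqrtr.
Qed.

End optimal_control.

(** * From norm estimates to weak convergence *)

Lemma cvg_at_right0_bound (R : realType) (f h : R -> R) (l : R) :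
    h nu @[nu --> 0^'+] --> 0 -> (forall nu, 0 < nu -> `|f nu - l| <= h nu) ->
  f nu @[nu --> 0^'+] --> l.
Proof.
move=> h0 fh; apply/cvgrPdist_le => e e0.
move/cvgrPdist_le : h0 => /(_ e e0) he.
near=> nu; have nu0 : 0 < nu by near: nu; exact: nbhs_right_gt.
rewrite distrC; apply: (le_trans (fh nu nu0)).
have : `|0 - h nu| <= e by near: nu.
by rewrite sub0r normrN; apply: le_trans; exact: ler_norm.
Unshelve. all: by end_near. Qed.

Theorem theorem3p4 (R : realType) (n : nat) (n23 : n = 2%N \/ n = 3%N)
    (Omega : set 'rV[R]_n) (domOmega : admissible_domain Omega)
    (A : 'I_n -> 'I_n -> 'rV[R]_n -> R) (a0 : 'rV[R]_n -> R)
    (coefA : coefficients Omega A a0)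
    (S : ('rV[R]_n -> R) -> 'rV[R]_n -> R)
    (S_op : solution_operator Omega A a0 S)
    (I : set 'rV[R]_n) (finI : finite_set I) (I_Omega : I `<=` Omega)
    (g : 'rV[R]_n -> R)
    (theta : R) (theta_ge0 : 0 <= theta)
    (gd : 'rV[R]_n -> R) (gdL2 : L2 Omega gd)
    (u : R -> 'rV[R]_n -> R)
    (u_min : forall nu, 0 < nu ->
      minimises (feasible_nu Omega S) (Jnu Omega I g theta nu gd)
        (S (u nu)) (u nu))
    (ubar : 'rV[R]_n -> R)
    (ubar_min : minimises (feasible Omega S I g) (J Omega theta gd)
        (S ubar) ubar) :
  (forall F, H10_dual Omega F -> F (S (u nu)) @[nu --> 0^'+] --> F (S ubar)) /\
  (forall F, L2_dual Omega F -> F (u nu) @[nu --> 0^'+] --> F ubar).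
Proof.
have [oO bO _] := domOmega.
have n_gt0 : (0 < n)%N by case: n23 => ->.
have mO := open_rV_measurable oO.
have [h [h0 uh]] := control_cvg oO bO n_gt0 coefA S_op theta_ge0 gdL2 finI I_Omega
  u_min ubar_min.
have [[_ Lub _ _] _] := ubar_min.
have Lu nu : 0 < nu -> L2 Omega (u nu) by move=> /u_min[[]].
have [K [K0 HK]] := weak_sol_bound oO bO coefA n_gt0.
split=> F [linF [C bF]].
(* [C] comes without a sign, hence the absolute value. *)
- apply: (@cvg_at_right0_bound _ _ (fun nu => `|C| * (K * h nu))) => [|nu nu0].
    rewrite -[X in _ --> X](mulr0 `|C|); apply: cvgM; first exact: cvg_cst.
    by rewrite -[X in _ --> X](mulr0 K); apply: cvgM => //; exact: cvg_cst.
  have Lnu := Lu nu nu0.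
  have [[_ [Hub _]] [_ [Hu _]]] := (S_op _ Lub, S_op _ Lnu).
  have -> : F (S (u nu)) - F (S ubar) = F (fun x => -1 * S ubar x + S (u nu) x).
    by rewrite linF//; ring.
  (* [F] acts on total functions, whereas linearity of [S] is established only on Omega. So the
     difference of the states is itself treated as a weak solution, with datum the difference of the
     controls. *)
  have := weak_sol_lin oO bO coefA (-1) Lub Lnu (solution_operator_weak_sol S_op Lub)
    (solution_operator_weak_sol S_op Lnu).
  move=> /(HK _ _ (L2_lin mO (-1) Lub Lnu))[Dy [Hy _ Dyh]].
  have Hy0 : H10 Omega (fun x => -1 * S ubar x + S (u nu) x).
    by apply/H10_gradP; exists Dy.
  apply: (le_trans (bF _ _ Hy0 Hy.1)).
  apply: (@le_trans _ _ (`|C| * H1norm Omega (fun x => -1 * S ubar x + S (u nu) x) Dy)).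
    by rewrite ler_wpM2r ?sqrtr_ge0// ler_norm.
  rewrite ler_wpM2l// (le_trans Dyh)// ler_wpM2l//; exact: uh.
- apply: (@cvg_at_right0_bound _ _ (fun nu => `|C| * h nu)) => [|nu nu0].
    by rewrite -[X in _ --> X](mulr0 `|C|); apply: cvgM => //; exact: cvg_cst.
  have Lnu := Lu nu nu0.
  have -> : F (u nu) - F ubar = F (fun x => -1 * ubar x + u nu x).
    by rewrite linF//; ring.
  apply: (le_trans (bF _ (L2_lin mO (-1) Lub Lnu))).
  apply: (@le_trans _ _ (`|C| * L2norm Omega (fun x => -1 * ubar x + u nu x))).
    by rewrite ler_wpM2r ?sqrtr_ge0// ler_norm.
  by rewrite ler_wpM2l//; exact: uh.
Qed.
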